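(* Let $\{q_n\}$ be the Fibonacci Quilt sequence and consider $m\in I_n:=[q_n,q_{n+1})$. Let $P_n(g)$ be the fraction of all gaps $\ell_i-\ell_{i+1}$ in the Greedy-6 decompositions $m=q_{\ell_1}+\dots+q_{\ell_t}$ ($\ell_1>\dots>\ell_t$) of all $m\in I_n$ that equal $g$. Then $P(g):=\lim_{n\to\infty}P_n(g)$ exists and agrees with the corresponding limit for the $(4,1)$-Generacci sequence, namely the limit as $n\to\infty$ of the fraction of gaps equal to $g$ among the $(4,1)$-Generacci legal decompositions of all integers in $[a_n,a_{n+1})$. Moreover, for $z$ chosen uniformly from $I_n$, the spacing gap measures $\nu_{z,n}(x)=\frac1{t(z)-1}\sum_{i=1}^{t(z)-1}\delta(x-(\ell_i-\ell_{i+1}))$ of the Greedy-6 decomposition converge almost surely in distribution to the limiting gap measure $\sum_g P(g)\delta(x-g)$ of the $(4,1)$-Generacci sequence.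
   Context: Given an increasing sequence $\{q_i\}$, a decomposition $m=q_{\ell_1}+\dots+q_{\ell_t}$ with $q_{\ell_1}>\dots>q_{\ell_t}$ is FQ-legal if $|\ell_i-\ell_j|\notin\{0,1,3,4\}$ for $i\neq j$ and $\{1,3\}\not\subset\{\ell_1,\dots,\ell_t\}$. The Fibonacci Quilt sequence has $q_1=1$ and each $q_i$ ($i\ge 2$) is the smallest positive integer with no FQ-legal decomposition using $q_1,\dots,q_{i-1}$ (it begins $1,2,3,4,5,7,9,12,\dots$). The Greedy-6 decomposition of $m$: if $m=q_n$ it is $q_n$; if $m=6$ it is $q_4+q_2$; otherwise write $m=q_{\ell_1}+x$ with $q_{\ell_1}<m<q_{\ell_1+1}$, $x>0$, and iterate on $x$. The $(4,1)$-Generacci sequence $\{a_n\}$ is the increasing sequence in which each $a_i$ is the smallest positive integer not expressible as a sum of distinct earlier terms $a_{\ell_1}+\dots+a_{\ell_k}$ with $\ell_i-\ell_{i+1}\ge5$; such decompositions (legal decompositions) exist and are unique for every positive integer. $t(z)$ denotes the number of summands of $z$; $\delta(x-a)$ is the Dirac mass at $a$. *)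

(* Defs.v *)
From HB Require Import structures.
From mathcomp Require Import all_boot all_order all_algebra.
From mathcomp Require Import all_classical all_reals all_analysis.
Set Implicit Arguments. Unset Strict Implicit. Unset Printing Implicit Defensive.
Import Order.TTheory GRing.Theory Num.Theory.
Import numFieldNormedType.Exports.
Local Open Scope classical_set_scope.
Local Open Scope ring_scope.

(* Fibonacci Quilt sequence.  Sequences are indexed from 1; the value  *)
(* at index 0 is irrelevant and left unconstrained.                    *)

Definition ndist (i j : nat) : nat := ((i - j) + (j - i))%N.

Definition fq_legal (L : seq nat) : bool :=
  [&& uniq L, all (fun l => 0 < l)%N L,
      all (fun i => all (fun j => (i == j) || (ndist i j \notin [:: 1; 3; 4]%N)) L) L
    & ~~ ((1 \in L) && (3 \in L))%N].

Definition has_fq_dec (q : nat -> nat) (i m : nat) : Prop :=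
  exists L : seq nat, [/\ fq_legal L, all (fun l => l < i)%N L & sumn (map q L) = m].

Definition FQ_seq (q : nat -> nat) : Prop :=
  q 1%N = 1%N /\
  forall i : nat, (2 <= i)%N ->
    [/\ (0 < q i)%N, ~ has_fq_dec q i (q i)
      & forall m : nat, (0 < m < q i)%N -> has_fq_dec q i m].

(* index l >= 1 with q_l <= m maximal (for increasing q this is the l
   with q_l <= m < q_{l+1}) *)
Definition fq_index (q : nat -> nat) (m : nat) : nat :=
  (\max_(1 <= l < m.+1 | (q l <= m)%N) l)%N.

(* Greedy-6 algorithm (with fuel; fuel m is enough since m decreases). *)
Fixpoint g6_aux (q : nat -> nat) (fuel m : nat) : seq nat :=
  match fuel with
  | 0%N => [::]
  | fuel'.+1 =>
    if m == 0%N then [::]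
    else let l := fq_index q m in
      if q l == m then [:: l]
      else if m == 6%N then [:: 4%N; 2%N]
      else l :: g6_aux q fuel' (m - q l)%N
  end.

Definition greedy6 (q : nat -> nat) (m : nat) : seq nat := g6_aux q m m.

Definition gen_legal_dec (a : nat -> nat) (L : seq nat) (m : nat) : Prop :=
  [/\ sorted (fun x y => y + 5 <= x)%N L, all (fun l => 0 < l)%N L
    & sumn (map a L) = m].

Definition Gen41_seq (a : nat -> nat) : Prop :=
  forall i : nat, (1 <= i)%N ->
    [/\ (0 < a i)%N,
        ~ (exists L, gen_legal_dec a L (a i) /\ all (fun l => l < i)%N L)
      & forall m : nat, (0 < m < a i)%N ->
          exists L, gen_legal_dec a L m /\ all (fun l => l < i)%N L].

Definition gaps (L : seq nat) : seq nat :=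
  [seq (x.1 - x.2)%N | x <- zip L (behead L)].

Definition gap_frac (R : realType) (dec : nat -> seq nat) (lo hi g : nat) : R :=
  (\sum_(lo <= m < hi) count_mem g (gaps (dec m)))%N%:R /
  (\sum_(lo <= m < hi) size (gaps (dec m)))%N%:R.

Definition PFQ (R : realType) (q : nat -> nat) (n g : nat) : R :=
  gap_frac R (greedy6 q) (q n) (q n.+1) g.

Definition PGen (R : realType) (decA : nat -> seq nat) (a : nat -> nat) (n g : nat) : R :=
  gap_frac R decA (a n) (a n.+1) g.

Definition Plim (R : realType) (q : nat -> nat) (g : nat) : R :=
  lim ((fun n => PFQ R q n g) @ \oo).

(* integral of f against the spacing gap measure
   nu = 1/(t-1) sum_{i=1}^{t-1} delta_{l_i - l_{i+1}} of decomposition L *)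
Definition nu_int (R : realType) (L : seq nat) (f : R -> R) : R :=
  (size (gaps L))%:R^-1 * \sum_(x <- gaps L) f x%:R.

Definition indep_nat (R : realType) (d : measure_display) (Omega : measurableType d)
  (P : probability Omega R) (Z : nat -> Omega -> nat) : Prop :=
  forall (S : seq nat) (m : nat -> nat), uniq S ->
    P [set w | all (fun k => Z k w == m k) S] =
    (\prod_(k <- S) fine (P (Z k @^-1` [set m k])))%:E.

(* Main.v *)
(* Both sequences satisfy b_(n+1) = b_n + b_(n-4), so for either of them the
   greedy decompositions of the integers in I_n = [b_n, b_(n+1)) are n alone, or n
   followed by the decomposition of an integer of I_k with k <= n - 5; Greedy-6
   differs from plain greedy only in the last two summands.  Hence the exponential
   moments F_n of the gap statistics over I_n obey the renewal recursion
   F_n = 1 + sum_(g >= 5) w(g) F_(n-g).  Let x be the root of x + x^5 = 1, so that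
   |I_n| grows like x^-n.  Bounding F_n and applying Chernoff's method, outside a
   geometrically small proportion of I_n the number of gaps is at least delta n and
   the proportion of gaps equal to g is within eps of x^g (of 0 when g < 5).
   Averaging over I_n gives the limit of P_n(g); Borel-Cantelli gives, almost
   surely, pointwise convergence of the gap measures to the probability x^g on
   g >= 5, which is convergence in distribution. *)

Require Import Defs.
From HB Require Import structures.
From mathcomp Require Import all_boot all_order all_algebra.
From mathcomp Require Import all_classical all_reals all_analysis.
From mathcomp Require Import zify ring lra.
Import Order.TTheory GRing.Theory Num.Theory.
Import numFieldNormedType.Exports.
Local Open Scope classical_set_scope.
Local Open Scope ring_scope.

(** * Greedy decompositions *)

Section GreedyDecomposition.
Local Open Scope nat_scope.

(* Satisfied by the Fibonacci Quilt and the (4,1)-Generacci sequences, which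
   differ only in their initial values. *)
Definition lag5_seq (b : nat -> nat) : Prop :=
  [/\ b 1 = 1, (forall n, 0 < n -> b n < b n.+1 <= 2 * b n)
    & forall n, 5 < n -> b n.+1 = b n + b (n - 4)].

Fixpoint greedy_aux (b : nat -> nat) (fuel m : nat) : seq nat :=
  match fuel with
  | 0 => [::]
  | fuel'.+1 =>
    if m == 0 then [::]
    else fq_index b m :: greedy_aux b fuel' (m - b (fq_index b m))
  end.

Definition greedy (b : nat -> nat) (m : nat) : seq nat := greedy_aux b m m.

Variable b : nat -> nat.
Hypotheses (b1 : b 1 = 1) (bS : forall n, 0 < n -> b n < b n.+1).

Lemma seq_homo i j : 0 < i -> i <= j -> b i <= b j.
Proof.
move=> i0; elim: j => [|j IH]; first by case: i i0.
rewrite leq_eqVlt => /orP[/eqP->//|ij].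
exact: leq_trans (IH ij) (ltnW (bS _ (leq_trans i0 ij))).
Qed.

Lemma seq_ge i : 0 < i -> i <= b i.
Proof.
case: i => // i _; elim: i => [|i IH]; first by rewrite b1.
exact: leq_ltn_trans IH (bS _ _).
Qed.

(** The maximum defining [fq_index] ranges over l <= m only; n is in that range because n <= b n. *)
Lemma fq_index_eq n m : 0 < n -> b n <= m < b n.+1 -> fq_index b m = n.
Proof.
move=> n0 /andP[nm mn]; rewrite /fq_index.
have nm1 : n < m.+1 by rewrite ltnS (leq_trans _ nm)// seq_ge.
apply/eqP; rewrite eqn_leq; apply/andP; split; last first.
  by apply: (leq_bigmax_seq (F := id)) => //; rewrite mem_index_iota n0.
apply/bigmax_leqP_seq => l; rewrite mem_index_iota => /andP[l1 _] lm.
rewrite leqNgt; apply/negP => nl.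
by have := seq_homo _ _ (isT : 0 < n.+1) nl; lia.
Qed.

Lemma interval_ex m : 0 < m -> exists2 n, 0 < n & b n <= m < b n.+1.
Proof.
move=> m0.
have ex : exists n, (0 < n) && (b n <= m) by exists 1; rewrite b1.
have ub n : (0 < n) && (b n <= m) -> n <= m.
  by case/andP => n0; apply: leq_trans; apply: seq_ge.
case: (ex_maxnP ex ub) => n /andP[n0 nm] nmax; exists n => //.
rewrite nm ltnNge; apply/negP => mn.
by have := nmax n.+1; rewrite mn => /(_ isT); rewrite ltnn.
Qed.

Lemma fq_indexP m : 0 < m ->
  0 < fq_index b m /\ b (fq_index b m) <= m < b (fq_index b m).+1.
Proof. by move=> /interval_ex[n n0 nm]; rewrite (fq_index_eq n). Qed.

Lemma greedy_aux_fuel f m : m <= f -> greedy_aux b f m = greedy b m.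
Proof.
have [k] := ubnP m; elim: k => // k IH in f m *.
case: m => [|m] mk; first by case: f.
case: f => // f mf; rewrite /greedy /=.
have [i0 im] := fq_indexP m.+1 isT.
have bi : 0 < b (fq_index b m.+1) by exact: leq_trans i0 (seq_ge _ i0).
congr cons; rewrite !IH//; lia.
Qed.

Lemma greedyE n m : 0 < n -> b n <= m < b n.+1 ->
  greedy b m = n :: greedy b (m - b n).
Proof.
move=> n0 nm; have bn := leq_trans n0 (seq_ge _ n0).
case: m nm => [|m] nm; first by lia.
rewrite /greedy /= (fq_index_eq n)// greedy_aux_fuel//; lia.
Qed.

Lemma gaps_cons2 x y s : gaps (x :: y :: s) = (x - y) :: gaps (y :: s).
Proof. by []. Qed.

Lemma gaps_greedy_cons n k x : 0 < k -> b k <= x < b k.+1 ->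
  gaps (n :: greedy b x) = (n - k) :: gaps (greedy b x).
Proof. by move=> k0 kx; rewrite (greedyE k). Qed.

Lemma size_gaps s : size (gaps s) = (size s).-1.
Proof.
rewrite size_map size_zip size_behead; apply/minn_idPr; exact: leq_pred.
Qed.

Lemma big_seq_intervals (T : Type) (idx : T) (op : Monoid.law idx) n (h : nat -> T) :
  0 < n -> \big[op/idx]_(1 <= x < b n) h x =
  \big[op/idx]_(1 <= k < n) \big[op/idx]_(b k <= x < b k.+1) h x.
Proof.
case: n => // n _; elim: n => [|n IH]; first by rewrite b1 !big_geq.
rewrite big_nat_recr//= -IH (big_cat_nat (n := b n.+1))//=.
- by have := seq_ge n.+1 isT; lia.
- exact/ltnW/bS.
Qed.

Hypotheses (b2 : forall n, 0 < n -> b n.+1 <= 2 * b n).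

(** Since b (k+1) <= 2 b k, the remainder m - b k is below b k, so the indices strictly decrease. *)
Lemma size_greedy m n : 0 < n -> m < b n.+1 -> size (greedy b m) <= n.
Proof.
elim: n m => // n IH m _ mn.
case: (posnP m) => [->//|m0]; have [k k0 km] := interval_ex _ m0.
have kn : k <= n.+1.
  rewrite leqNgt; apply/negP => nk; have := seq_homo n.+2 k isT nk; lia.
rewrite (greedyE k)//= ltnS.
case: n IH mn kn => [|n] IH mn kn.
  have k1 : k = 1 by lia.
  subst k.
  by have := b2 1 isT; rewrite b1 => H; have -> : m - 1 = 0 by rewrite b1 in km; lia.
apply: IH => //.
have := b2 k k0; have := seq_homo k n.+2 k0 kn; lia.
Qed.

End GreedyDecomposition.

(** * Exponential moments and concentration of the gaps *)

Section ExponentialMoments.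
Variables (R : realType) (b : nat -> nat) (g0 : nat) (al be : R).
Hypothesis hb : lag5_seq b.

Let b1 : b 1 = 1%N. Proof. by case: hb. Qed.
Let bS n : (0 < n -> b n < b n.+1)%N.
Proof. by case: hb => _ h _ /h/andP[]. Qed.
Let b_rec n : (5 < n -> b n.+1 = b n + b (n - 4))%N.
Proof. by case: hb => _ _; apply. Qed.

Definition exp_weight (s : seq nat) : R :=
  expR (al * (count_mem g0 s)%:R + be * (size s)%:R).

Definition exp_moment (n : nat) : R :=
  \sum_(b n <= m < b n.+1) exp_weight (gaps (greedy b m)).

Lemma exp_weight_cons x s :
  exp_weight (x :: s) = expR (al * (x == g0)%:R + be) * exp_weight s.
Proof. by rewrite /exp_weight -expRD /= natrD -addn1 natrD; congr expR; ring. Qed.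

(** The term 1 is m = b n, which has no gap. Every other m is b n + x with 0 < x < b (n - 4);
    sorting x by its interval I_k splits off the first gap n - k, which is at least 5. *)
Lemma exp_moment_rec n : (5 < n)%N ->
  exp_moment n = 1 + \sum_(1 <= k < n - 4)
    expR (al * (n - k == g0)%N%:R + be) * exp_moment k.
Proof.
move=> n5; rewrite /exp_moment -{1}[b n]add0n big_addn b_rec// addKn.
have n4 : (0 < n - 4)%N by lia.
have bn4 : (0 < b (n - 4))%N by exact: leq_trans n4 (seq_ge b b1 bS _ n4).
have gr x : (x < b (n - 4))%N -> greedy b (x + b n) = n :: greedy b x.
  move=> xb; rewrite (greedyE b b1 bS n) ?addnK//; first lia.
  by rewrite leq_addl b_rec//= addnC ltn_add2l.
rewrite big_ltn//; congr (_ + _).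
  by rewrite gr// /exp_weight /= !mulr0 addr0 expR0.
rewrite (big_seq_intervals b b1 bS) //; rewrite !big_nat; apply: eq_bigr => k /andP[k1 kn].
rewrite big_distrr/= !big_nat; apply: eq_bigr => x /andP[kx xk].
rewrite gr; last by rewrite (leq_trans xk)// (seq_homo b bS).
by rewrite (gaps_greedy_cons b b1 bS n k) ?kx // exp_weight_cons.
Qed.

Lemma sum_geometric_lag5 (y : R) n : 0 < y < 1 -> (5 < n)%N ->
  \sum_(1 <= k < n - 4) y ^- k = (y ^+ 5 / y ^+ n - 1) / (1 - y).
Proof.
move=> /andP[y0 y1]; have y0' : y != 0 by rewrite gt_eqF.
have y1' : 1 - y != 0 by rewrite subr_eq0 gt_eqF.
case: n => [|[|[|[|[|[|n]]]]]]// _; rewrite (_ : n.+1 .+4.+1 - 4 = n.+2)%N; last lia.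
elim: n => [|n IH].
  by rewrite big_nat1; field; rewrite y0' y1'.
rewrite big_nat_recr//= IH !exprS; field.
by rewrite y0' y1' expf_neq0.
Qed.

Lemma exp_moment_ge0 n : 0 <= exp_moment n.
Proof. by apply: sumr_ge0 => m _; exact: expR_ge0. Qed.

(** With w(g) the weight of a gap, the condition says that w(g) y^g summed over g >= 5 is at most 1;
    y^5 / (1 - y) is the sum of y^g over g >= 5. This makes C y^-n a supersolution of the renewal
    recursion. *)
Lemma exp_moment_le (y : R) : 0 < y < 1 ->
  expR be * (y ^+ 5 / (1 - y) + (expR al - 1) * ((4 < g0)%N%:R * y ^+ g0)) <= 1 ->
  exists2 C : R, 0 < C & forall n, (0 < n)%N -> exp_moment n <= C / y ^+ n.
Proof.
move=> y01 cond; have /andP[y0 y1] := y01.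
have y1' : 0 < 1 - y by rewrite subr_gt0.
(* Above n0 the recursion holds and the gap g0 fits. The sum in [C] covers n <= n0; the term (1 - y)
   / expR be pays for the inhomogeneous 1, through the slack left by truncating the geometric
   series. *)
set n0 := maxn g0 5.
set C := (1 - y) / expR be + \sum_(0 <= k < n0.+1) exp_moment k.
have Cs : (1 - y) / expR be <= C by rewrite lerDl sumr_ge0 // => k _; exact: exp_moment_ge0.
have C0 : 0 < C by apply: lt_le_trans Cs; rewrite divr_gt0 ?expR_gt0.
exists C => // n; have [k] := ubnP n; elim: k n => // k IH n nk npos.
have yn0 m : 0 < y ^+ m by rewrite exprn_gt0.
have [nn0|nn0] := leqP n n0.
  rewrite ler_pdivlMr//.
  apply: (@le_trans _ _ (exp_moment n)).
    rewrite ler_piMr ?exp_moment_ge0// exprn_ile1// ltW//.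
  rewrite /C (bigD1_seq n) ?iota_uniq ?mem_index_iota//= addrCA lerDl addr_ge0//.
    by rewrite divr_ge0 ?expR_ge0 ?ltW.
  by apply: sumr_ge0 => j _; exact: exp_moment_ge0.
have n5 : (5 < n)%N by move: nn0; rewrite /n0; lia.
have gn : (g0 < n)%N by move: nn0; rewrite /n0; lia.
rewrite exp_moment_rec//.
apply: (@le_trans _ _ (1 + C * \sum_(1 <= k < n - 4)
    expR (al * (n - k == g0)%N%:R + be) / y ^+ k)).
  rewrite lerD2l big_distrr/= !big_nat; apply: ler_sum => j /andP[j1 jn].
  rewrite mulrCA ler_wpM2l ?expR_ge0// IH//; lia.
have -> : \sum_(1 <= k < n - 4) expR (al * (n - k == g0)%N%:R + be) / y ^+ k =
  expR be * ((y ^+ 5 / y ^+ n - 1) / (1 - y) +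
    (expR al - 1) * ((4 < g0)%N%:R * y ^+ g0) / y ^+ n).
  rewrite -sum_geometric_lag5//.
  under eq_bigr => j _.
    rewrite (_ : expR _ / _ = expR be * (y ^- j + (expR al - 1) * ((n - j == g0)%N%:R / y ^+ j))); last first.
      by rewrite expRD; case: eqP => _ /=; rewrite ?mulr1 ?mulr0 ?expR0; ring.
    over.
  rewrite -mulr_sumr big_split/= -mulr_sumr; congr (_ * (_ + _)).
  rewrite -mulrA; congr (_ * _).
  (* The sum reaches only gaps n - j >= 5: exactly one j gives g0 if g0 > 4, none otherwise. *)
  have [g4|g4] := ltnP 4 g0; last first.
    rewrite !mul0r big_nat big1// => j /andP[j1 jn].
    have -> : (n - j == g0)%N = false by apply/negP => /eqP; lia.
    by rewrite mul0r.
  rewrite (bigD1_seq (n - g0)%N) ?iota_uniq ?mem_index_iota//=; last by lia.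
  rewrite subKn ?(ltnW gn)// eqxx mul1r big_nat_cond big1 ?addr0; last first.
    move=> j /andP[/andP[j1 jn] jg].
    have -> : (n - j == g0)%N = false by apply/negP => /eqP; move/eqP: jg; lia.
    by rewrite mul0r.
  rewrite !mul1r -{2}(subnK (ltnW gn)) exprD invfM mulrCA divff ?mulr1//.
  by rewrite gt_eqF.
set T := (expR al - 1) * _ in cond *.
have : C / y ^+ n * (expR be * (y ^+ 5 / (1 - y) + T)) <= C / y ^+ n.
  by rewrite ler_piMr// divr_ge0// ltW.
apply: le_trans.
rewrite -subr_ge0.
have -> : C / y ^+ n * (expR be * (y ^+ 5 / (1 - y) + T)) -
   (1 + C * (expR be * ((y ^+ 5 / y ^+ n - 1) / (1 - y) + T / y ^+ n))) =
   C * expR be / (1 - y) - 1.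
  by field; rewrite gt_eqF //= gt_eqF.
by rewrite subr_ge0 ler_pdivlMr// mul1r -ler_pdivrMr ?expR_gt0.
Qed.

End ExponentialMoments.

(** * Exponentially rare sets of integers *)

Section RareEvents.
Variables (R : realType) (b : nat -> nat).

Definition freq (n : nat) (E : pred nat) : R :=
  (\sum_(b n <= m < b n.+1) E m)%N%:R / (b n.+1 - b n)%N%:R.

(** Geometric decay is stable under finite unions and summable, as Borel-Cantelli requires. *)
Definition rare (E : nat -> pred nat) : Prop :=
  exists C r : R, [/\ 0 <= C, 0 < r < 1 & forall n, freq n (E n) <= C * r ^+ n].

Lemma freq_le n (E E' : pred nat) :
  (forall m, (b n <= m < b n.+1)%N -> E m -> E' m) -> freq n E <= freq n E'.
Proof.
move=> EE'; rewrite ler_wpM2r ?invr_ge0// ler_nat !big_nat.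
by apply: leq_sum => m /EE'; case: (E m) => // ->.
Qed.

Lemma freq_le1 n E : freq n E <= 1.
Proof.
apply: (@le_trans _ _ (freq n predT)); first exact: freq_le.
rewrite /freq sum_nat_const_nat muln1.
by case: (b n.+1 - b n)%N => [|k]; rewrite ?mul0r// divff// pnatr_eq0.
Qed.

Lemma freqU n (E E' : pred nat) : freq n (predU E E') <= freq n E + freq n E'.
Proof.
rewrite -mulrDl ler_wpM2r ?invr_ge0// -natrD -big_split ler_nat.
by apply: leq_sum => m _ /=; case: (E m); case: (E' m).
Qed.

Lemma rare_eventually (E : nat -> pred nat) (C r : R) N : 0 < r < 1 ->
  (forall n, (N <= n)%N -> freq n (E n) <= C * r ^+ n) -> rare E.
Proof.
move=> r01 EN; have /andP[r0 r1] := r01.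
have rN : 0 <= r ^- N by rewrite invr_ge0 exprn_ge0 // ltW.
(* For n < N the summand r^-N makes the bound at least 1, which no frequency exceeds. *)
exists (`|C| + r ^- N), r; split=> //; first exact: addr_ge0.
move=> n; have [/EN h|nN] := leqP N n.
  apply: le_trans h _; rewrite ler_wpM2r ?exprn_ge0 ?(ltW r0)//.
  by rewrite (le_trans (ler_norm C))// lerDl.
apply: le_trans (freq_le1 n _) _; rewrite mulrDl.
apply: (@le_trans _ _ (r ^- N * r ^+ n)); last first.
  by rewrite lerDr mulr_ge0// exprn_ge0 // ltW.
rewrite mulrC ler_pdivlMr ?exprn_gt0// mul1r.
by apply: ler_wiXn2l; [exact: ltW|exact: ltW|exact: ltnW].
Qed.

Lemma rareU E E' : rare E -> rare E' -> rare (fun n => predU (E n) (E' n)).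
Proof.
move=> [C [r [C0 r01 Er]]] [C' [r' [C0' r01' Er']]].
move: r01 r01' => /andP[r0 r1] /andP[r0' r1'].
set s := Num.max r r'.
have [rs rs'] : r <= s /\ r' <= s by rewrite /s !le_max !lexx orbT.
have s0 : 0 < s by exact: lt_le_trans r0 rs.
exists (C + C'), s; split; first exact: addr_ge0.
  by rewrite s0 gt_max r1.
move=> n; apply: le_trans (freqU _ _ _) _; rewrite mulrDl lerD//.
  apply: le_trans (Er n) _; rewrite ler_wpM2l//.
  by rewrite lerXn2r ?nnegrE ?(ltW r0) ?(ltW s0).
apply: le_trans (Er' n) _; rewrite ler_wpM2l//.
by rewrite lerXn2r ?nnegrE ?(ltW r0') ?(ltW s0).
Qed.

Lemma rare_sub (E E' : nat -> pred nat) N : rare E' ->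
  (forall n m, (N <= n)%N -> (b n <= m < b n.+1)%N -> E n m -> E' n m) -> rare E.
Proof.
move=> [C [r [_ r01 Er]]] EE'; apply: (rare_eventually _ C r N) => // n Nn.
by apply: le_trans (Er n); apply: freq_le => m; exact: EE'.
Qed.

End RareEvents.

(** This x is the inverse of the plastic number, since y^5 - y^4 - 1 = (y^3 - y - 1)(y^2 - y +
    1). *)
Lemma plastic_root_ex (R : realType) : exists2 x : R, 0 < x < 1 & x + x ^+ 5 = 1.
Proof.
have [] := @poly_ivt R ('X + 'X^5 - 1) 0 1 ler01.
  by rewrite !hornerE /= expr0n expr1n /= sub0r lerN10 addrK ler01.
move=> x /andP[x0 x1] /rootP.
rewrite !hornerE => /= x5.
have e : x + x ^+ 5 = 1 by apply/eqP; rewrite -subr_eq0 x5.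
exists x => //; rewrite !lt_neqAle x0 x1 !andbT.
apply/andP; split; apply/eqP => h; move: e.
  by rewrite -h expr0n addr0 => /eqP; rewrite eq_sym oner_eq0.
by rewrite h expr1n => /eqP; rewrite -[eqbRHS]addr0 (inj_eq (addrI 1)) oner_eq0.
Qed.

(* In the limit the gaps are i.i.d. with law x^g on g >= 5, a probability since
   x^5 / (1 - x) = 1. *)
Definition limit_gap_prob (R : realType) (x : R) (g : nat) : R :=
  (4 < g)%N%:R * x ^+ g.

Lemma limit_gap_prob_ge0 (R : realType) (y : R) g : 0 <= y -> 0 <= limit_gap_prob R y g.
Proof. by move=> y0; rewrite mulr_ge0// exprn_ge0. Qed.

(** Inverting expR (- u) >= 1 - u gives (1 - u) expR u <= 1, while (1 - u)(1 + u + 2u^2) = 1 + u^2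
    (1 - 2u) is at least 1 for u <= 1/2. *)
Lemma expR_le_quadratic (R : realType) (u : R) : u <= 1 / 2 -> expR u <= 1 + u + 2 * u ^+ 2.
Proof.
move=> u2; have := expR_ge1Dx (- u); rewrite expRN => h.
have e0 := expR_gt0 u.
have : (1 - u) * expR u <= 1 by rewrite -ler_pdivlMr// mul1r.
move=> h1; have : 1 <= (1 - u) * (1 + u + 2 * u ^+ 2) by nra.
move=> h2; have u1 : 0 < 1 - u by lra.
by rewrite -(ler_pM2l u1) (le_trans h1).
Qed.

(** * Concentration of the gap proportions *)

Section GapConcentration.
Variables (R : realType) (b : nat -> nat) (x : R).
Hypotheses (hb : lag5_seq b) (x01 : 0 < x < 1) (x5 : x + x ^+ 5 = 1).

Let x0 : 0 < x. Proof. by case/andP: x01. Qed.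
Let x1 : x < 1. Proof. by case/andP: x01. Qed.
Let b1 : b 1 = 1%N. Proof. by case: hb. Qed.
Let bS n : (0 < n -> b n < b n.+1)%N.
Proof. by case: hb => _ h _ /h/andP[]. Qed.
Let b_rec n : (5 < n -> b n.+1 = b n + b (n - 4))%N.
Proof. by case: hb => _ _; apply. Qed.

(** By x + x^5 = 1, the sequence x^-n obeys the recursion of b; the constant x^6 keeps the bound at
    most 1 for n <= 6. *)
Lemma seq_growth : exists2 c : R, 0 < c & forall n, (0 < n)%N -> c / x ^+ n <= (b n)%:R.
Proof.
exists (x ^+ 6); first by rewrite exprn_gt0.
move=> n; have [k] := ubnP n; elim: k n => // k IH n nk n0.
have [n6|n6] := leqP n 6.
  apply: (@le_trans _ _ 1).
    by rewrite ler_pdivrMr ?exprn_gt0// mul1r ler_wiXn2l ?(ltW x0) ?(ltW x1).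
  by rewrite ler1n; exact: leq_trans n0 (seq_ge b b1 bS _ n0).
case: n nk n0 n6 => // n nk _ n6; rewrite b_rec// natrD.
have h1 : x ^+ 6 / x ^+ n <= (b n)%:R by apply: IH; lia.
have h2 : x ^+ 6 / x ^+ (n - 4) <= (b (n - 4))%:R by apply: IH; lia.
apply: le_trans (lerD h1 h2).
have -> : x ^- n = x / x ^+ n.+1 by rewrite exprS invfM mulrA divff ?gt_eqF ?mul1r.
have -> : x ^- (n - 4) = x ^+ 5 / x ^+ n.+1.
  have e : n.+1 = (5 + (n - 4))%N by lia.
  by rewrite e exprD invfM mulrA divff ?mul1r // expf_neq0 // gt_eqF.
by rewrite -mulrDr -mulrDl x5 mul1r.
Qed.

(* Exponential Markov inequality; the interval I_n has at least c x^-n elements,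
   whereas the moment is at most C (x expR eta)^-n. *)
Lemma rare_chernoff g (al be eta tau : R) :
  x * expR eta < 1 -> 0 < eta + tau ->
  expR be * ((x * expR eta) ^+ 5 / (1 - x * expR eta) +
    (expR al - 1) * limit_gap_prob _ (x * expR eta) g) <= 1 ->
  rare R b (fun n m => tau * n%:R <= al * (count_mem g (gaps (greedy b m)))%:R
                                   + be * (size (gaps (greedy b m)))%:R).
Proof.
set y := x * expR eta => y1 et cond.
have y0 : 0 < y by rewrite mulr_gt0 ?expR_gt0.
have [|C C0 momC] := exp_moment_le R b g al be hb y _ cond; first by rewrite y0.
have [c c0 cb] := seq_growth.
(* Markov's inequality contributes expR (- tau n), and y^-n against x^-n contributes expR (- eta n),
   hence the rate. The factor x^4 comes from |I_n| = b (n - 4). *)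
apply: (@rare_eventually _ _ _ (C / (c * x ^+ 4)) (expR (- (eta + tau))) 6).
  by rewrite expR_gt0 expR_lt1 oppr_lt0.
move=> n n6.
have bI : (b n.+1 - b n = b (n - 4))%N by rewrite b_rec// addKn.
have bI0 : (0 < b (n - 4))%N by apply: leq_trans (seq_ge b b1 bS _ _); lia.
rewrite /freq bI ler_pdivrMr ?ltr0n//.
apply: (@le_trans _ _ (expR (- tau * n%:R) * exp_moment R b g al be n)).
  rewrite natr_sum mulr_sumr; apply: ler_sum => m _.
  rewrite /exp_weight -expRD; case: (boolP (_ <= _ + _)) => h /=; last exact: expR_ge0.
  apply: le_trans (expR_ge1Dx _); rewrite lerDl; lra.
have n0 : (0 < n)%N by lia.
apply: (@le_trans _ _ (expR (- tau * n%:R) * (C / y ^+ n))).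
  by rewrite ler_wpM2l ?expR_ge0// momC.
apply: (@le_trans _ _ (C / (c * x ^+ 4) * expR (- (eta + tau)) ^+ n * (c / x ^+ (n - 4)))); last first.
  rewrite ler_wpM2l ?cb//; last lia.
  by rewrite mulr_ge0 ?exprn_ge0 ?expR_ge0// divr_ge0 ?mulr_ge0 ?exprn_ge0 ?(ltW c0) ?(ltW C0) ?(ltW x0).
rewrite le_eqVlt; apply/orP; left; apply/eqP.
have -> : expR (- (eta + tau)) ^+ n = expR (- tau * n%:R) / expR eta ^+ n.
  by rewrite -!expRM_natr -expRN -expRD; congr expR; ring.
have xn : x ^+ n = x ^+ 4 * x ^+ (n - 4) by rewrite -exprD; congr (_ ^+ _); lia.
rewrite /y exprMn xn; field.
by rewrite !expf_neq0 ?(gt_eqF x0)// !gt_eqF ?expR_gt0.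
Qed.

(* The tilt s is taken small: at first order in s the moment condition reads
   u p - 5 k <= u p, which leaves room for the quadratic error terms. *)
Lemma rare_gap_deviation g (sg eps : R) : `|sg| = 1 -> 0 < eps ->
  rare R b (fun n m => eps * n%:R <= sg * ((count_mem g (gaps (greedy b m)))%:R
       - limit_gap_prob _ x g * (size (gaps (greedy b m)))%:R)).
Proof.
move=> sg1 eps0; set p := limit_gap_prob _ x g.
(* The parameters will be al = u = sg s, be = - u p, eta = - k and tau = s eps = 2 k, so that eta +
   tau = k > 0. [D] gathers the quadratic errors: 50 e^2 from expR (- 5 k), 2 from expR u, e g from
   y^g against x^g; its last term 10 e forces s <= 1/2. *)
pose e := eps / 2; have e0 : 0 < e by rewrite divr_gt0.
pose D := 50 * e ^+ 2 + 2 + e * g%:R + 10 * e.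
have eg : 0 <= e * g%:R by rewrite mulr_ge0// ltW.
have e2 : 0 <= e ^+ 2 by exact: sqr_ge0.
have D0 : 0 < D by rewrite /D; lra.
pose s := 5 * e / D.
have s0 : 0 < s by rewrite divr_gt0// mulr_gt0.
have sD : s * D = 5 * e by rewrite /s mulfVK// gt_eqF.
have s2 : s <= 1 / 2 by rewrite /s ler_pdivrMr// /D; lra.
pose k := s * e.
have k0 : 0 < k by rewrite mulr_gt0.
pose y := x * expR (- k).
have y0 : 0 < y by rewrite mulr_gt0 ?expR_gt0.
have ek1 : expR (- k) <= 1 by rewrite expR_le1; lra.
have yx : y <= x by rewrite /y ler_piMr ?(ltW x0).
have y1 : y < 1 by exact: le_lt_trans yx x1.
set u := sg * s.
have us : `|u| = s by rewrite normrM sg1 mul1r gtr0_norm.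
have uu : u ^+ 2 = s ^+ 2 by rewrite -us real_normK ?num_real.
have u2 : u <= 1 / 2 by apply: le_trans (ler_norm u) _; rewrite us.
(* As x^5 = 1 - x and y <= x, the quotient is expR (- 5 k) (1 - x) / (1 - y) <= expR (- 5 k). *)
have base : y ^+ 5 / (1 - y) <= 1 - 5 * k + 50 * k ^+ 2.
  have : y ^+ 5 / (1 - y) <= expR (- (5 * k)).
    rewrite ler_pdivrMr ?subr_gt0// /y exprMn -expRM_natl mulrN mulrC.
    rewrite ler_wpM2l ?expR_ge0// -/y (_ : x ^+ 5 = 1 - x) ?lerB//.
    by rewrite -x5 addrC addKr.
  move/le_trans; apply; apply: le_trans (expR_le_quadratic _ _ _) _; first lra.
  by rewrite le_eqVlt; apply/orP; left; apply/eqP; ring.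
set Y := limit_gap_prob R y g.
have p0 : 0 <= p by apply: limit_gap_prob_ge0; exact: ltW.
have Y1 : Y <= 1.
  rewrite /Y /limit_gap_prob; case: (4 < g)%N; rewrite ?mul0r// mul1r.
  by rewrite exprn_ile1// ltW.
have Yp : Y <= p.
  by rewrite /Y /p ler_wpM2l// lerXn2r ?nnegrE// ltW.
have pY : p - k * g%:R <= Y.
  rewrite /Y /p /limit_gap_prob; case: (4 < g)%N; rewrite ?mul0r ?mul1r; last first.
    by rewrite sub0r oppr_le0 mulr_ge0// ltW.
  rewrite /y exprMn -expRM_natr.
  have := expR_ge1Dx (- k * g%:R).
  have xg : 0 <= x ^+ g <= 1 by rewrite exprn_ge0 ?exprn_ile1// ltW.
  have kg : 0 <= k * g%:R by rewrite mulr_ge0// ltW.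
  nra.
have Y0 : 0 <= Y by apply: limit_gap_prob_ge0; exact: ltW.
have main : (expR u - 1) * Y <= u * p + s * (k * g%:R) + 2 * s ^+ 2.
  have h1 : (expR u - 1) * Y <= (u + 2 * u ^+ 2) * Y.
    by rewrite ler_wpM2r//; have := expR_le_quadratic _ u u2; lra.
  have h2 : u * (Y - p) <= s * (k * g%:R).
    apply: le_trans (ler_norm _) _; rewrite normrM us ler_wpM2l ?(ltW s0)//.
    by rewrite ler_norml; lra.
  rewrite uu in h1; nra.
apply: (@rare_sub _ _ _ _ 0 (rare_chernoff g u (- (u * p)) (- k) (s * eps) _ _ _)).
- by [].
- by rewrite /k /e; nra.
(* After multiplication by expR (u p), it suffices to bound the bracket by 1 + u p. The choice s D =
   5 e leaves exactly the surplus 10 s k. *)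
- rewrite -/y -/Y expRN mulrC ler_pdivrMr ?expR_gt0// mul1r.
  apply: le_trans (expR_ge1Dx _).
  have fin : 5 * k - 50 * k ^+ 2 - s * (k * g%:R) - 2 * s ^+ 2 = 10 * s * k.
    have -> : 5 * k = s * (s * D) by rewrite sD /k; ring.
    by rewrite /k /D; ring.
  have sk : 0 <= s * k by rewrite mulr_ge0 ?ltW.
  lra.
- move=> n m _ _ h.
  rewrite -mulrA (le_trans (ler_wpM2l (ltW s0) h))// le_eqVlt; apply/orP; left.
  by apply/eqP; rewrite /u /p; ring.
Qed.

(** Take y strictly between x and 1. The tilt be = - K with K = y^5 / (1 - y) meets the moment
    condition, as K <= expR K, so the moment grows at most like y^-n, exponentially slower than
    |I_n|. With delta = eta / (2 K), half of the gain eta survives. *)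
Lemma rare_few_gaps : exists2 delta : R, 0 < delta &
  rare R b (fun n m => (size (gaps (greedy b m)))%:R <= delta * n%:R).
Proof.
have x0' := x0; have x1' := x1; pose y := (1 + x) / 2.
have y0 : 0 < y by rewrite /y; lra.
have y1 : y < 1 by rewrite /y; lra.
have xy : x < y by rewrite /y; lra.
pose eta := ln (y / x).
have yE : x * expR eta = y.
  have yx0 : 0 < y / x by exact: divr_gt0.
  by rewrite /eta lnK ?posrE// mulrC mulfVK// gt_eqF.
have eta0 : 0 < eta by rewrite ln_gt0// ltr_pdivlMr// mul1r.
pose K := y ^+ 5 / (1 - y).
have K0 : 0 < K by rewrite divr_gt0 ?exprn_gt0 ?subr_gt0.
exists (eta / (2 * K)); first by apply: divr_gt0 => //; exact: mulr_gt0.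
apply: (@rare_sub _ _ _ _ 0 (rare_chernoff 0 0 (- K) eta (- eta / 2) _ _ _)).
- by rewrite yE.
- lra.
- rewrite yE expR0 subrr mul0r addr0 expRN mulrC ler_pdivrMr ?expR_gt0// mul1r.
  by apply: le_trans (expR_ge1Dx K); rewrite lerDr.
- move=> n m _ _ h; have := ler_wpM2l (ltW K0) h.
  have -> : K * (eta / (2 * K) * n%:R) = eta / 2 * n%:R by field; rewrite gt_eqF.
  lra.
Qed.

(** The slack 2 is what replacing the ending q_5 + q_1 by q_4 + q_2 can cost: it alters the gap
    before the ending and the gap inside it. *)
Definition gap_close (dec : nat -> seq nat) : Prop :=
  forall m, (0 < m)%N ->
  size (gaps (dec m)) = size (gaps (greedy b m)) /\
  forall g, (count_mem g (gaps (dec m)) <= count_mem g (gaps (greedy b m)) + 2)%N /\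
    (count_mem g (gaps (greedy b m)) <= count_mem g (gaps (dec m)) + 2)%N.

Definition good_gaps (dec : nat -> seq nat) (delta eps : R) (g n : nat) : pred nat :=
  fun m => (delta * n%:R <= (size (gaps (dec m)))%:R) &&
   (`|(count_mem g (gaps (dec m)))%:R - limit_gap_prob R x g * (size (gaps (dec m)))%:R|
     <= eps * (size (gaps (dec m)))%:R).

Lemma rare_bad_gaps dec : gap_close dec -> exists2 delta : R, 0 < delta &
  forall g (eps : R), 0 < eps -> rare R b (fun n => predC (good_gaps dec delta eps g n)).
Proof.
move=> close; have [delta d0 few] := rare_few_gaps; exists delta => // g eps eps0.
pose e := eps * delta / 2.
have e0 : 0 < e by rewrite divr_gt0// mulr_gt0.
have up := rare_gap_deviation g 1 e (normr1 _) e0.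
have dn := rare_gap_deviation g (- 1) e (normrN1 _) e0.
(* For n > 2 / e the slack 2 is at most e n; with the deviation e n this gives 2 e n = eps delta n,
   at most eps times the number of gaps. *)
apply: (@rare_sub _ _ _ _ (Num.truncn (2 / e)).+1 (rareU _ _ _ _ few (rareU _ _ _ _ up dn))).
move=> n m Nn /andP[nm _] /=; apply: contraNT; rewrite !negb_or -!ltNge.
move=> /and3P[h1 h2 h3].
have m0 : (0 < m)%N.
  have n0 : (0 < n)%N by lia.
  by apply: leq_trans nm; apply: leq_trans n0 (seq_ge b b1 bS _ n0).
have [sz cnt] := close m m0; have [c1 c2] := cnt g.
have n2 : 2 <= e * n%:R.
  rewrite mulrC -ler_pdivrMr//; apply: le_trans (ltW (truncnS_gt _)) _.
  by rewrite ler_nat.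
rewrite /good_gaps sz (ltW h1)/=.
move: c1 c2; rewrite -!(ler_nat R) !natrD => c1 c2.
have es : eps * (delta * n%:R) <= eps * (size (gaps (greedy b m)))%:R.
  by rewrite ler_wpM2l// ltW.
have ee : eps * (delta * n%:R) = 2 * (e * n%:R) by rewrite /e; field.
rewrite ee in es.
by rewrite ler_norml; apply/andP; split; lra.
Qed.

End GapConcentration.

(** * Limit of the gap fractions averaged over I_n *)

Section GapFraction.
Variables (R : realType) (b : nat -> nat) (x : R) (dec : nat -> seq nat).
Hypotheses (hb : lag5_seq b) (x01 : 0 < x < 1) (x5 : x + x ^+ 5 = 1).
Hypothesis (close : gap_close b dec).

Let x0 : 0 < x. Proof. by case/andP: x01. Qed.
Let x1 : x < 1. Proof. by case/andP: x01. Qed.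
Let b1 : b 1 = 1%N. Proof. by case: hb. Qed.
Let bS n : (0 < n -> b n < b n.+1)%N.
Proof. by case: hb => _ h _ /h/andP[]. Qed.
Let b2 n : (0 < n -> b n.+1 <= 2 * b n)%N.
Proof. by case: hb => _ h _ /h/andP[]. Qed.

Lemma limit_gap_prob_le1 g : limit_gap_prob R x g <= 1.
Proof.
rewrite /limit_gap_prob; case: (4 < g)%N; rewrite ?mul0r// mul1r.
by rewrite exprn_ile1// ltW.
Qed.

Lemma size_gaps_dec n m : (0 < n)%N -> (b n <= m < b n.+1)%N ->
  (size (gaps (dec m)) <= n)%N.
Proof.
move=> n0 /andP[nm mn].
have m0 : (0 < m)%N by apply: leq_trans nm; apply: leq_trans n0 (seq_ge b b1 bS _ n0).
have [-> _] := close m m0; rewrite size_gaps (leq_trans (leq_pred _))//.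
exact: (size_greedy b b1 bS b2).
Qed.

Lemma gap_frac_cvg g :
  (fun n => gap_frac R dec (b n) (b n.+1) g) @ \oo --> limit_gap_prob R x g.
Proof.
have [delta d0 badr] := rare_bad_gaps R b x hb x01 x5 dec close.
apply/cvgrPdist_le => /= eps eps0.
have eps2 : 0 < eps / 2 by rewrite divr_gt0.
have [C [r [C0 /andP[r0 r1] Cr]]] := badr g (eps / 2) eps2.
(* With c the length of I_n and B the number of its bad members, 1/2 keeps half of I_n good, so that
   S >= delta n c / 2; then eps delta / 4 gives n B <= eps S / 2. *)
pose e := Num.min (1 / 2) (eps * delta / 4).
have e0 : 0 < e by rewrite lt_min !divr_gt0 ?mulr_gt0.
have [e12 ed] : e <= 1 / 2 /\ e <= eps * delta / 4 by rewrite /e !ge_min !lexx orbT.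
have : \forall n \near \oo, `|geometric C r n| < e.
  have := @cvg_geometric R C r; rewrite gtr0_norm// => /(_ r1).
  by move/cvgr0_norm_lt; apply.
move=> near_e; near=> n.
have n0 : (0 < n)%N by near: n; exists 1%N.
have small : C * r ^+ n < e.
  by apply: le_lt_trans (ler_norm _) _; near: n.
set p := limit_gap_prob R x g.
have p0 : 0 <= p by apply: limit_gap_prob_ge0; exact: ltW.
have p1 : p <= 1 by exact: limit_gap_prob_le1.
have cI : (b n < b n.+1)%N by exact: bS.
set c : R := (b n.+1 - b n)%N%:R.
have c0 : 0 < c by rewrite ltr0n subn_gt0.
have n0' : 0 < n%:R :> R by rewrite ltr0n.
pose bad := predC (good_gaps R x dec delta (eps / 2) g n).
set B : R := (\sum_(b n <= m < b n.+1) bad m)%N%:R.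
have Bc : B <= C * r ^+ n * c by rewrite -ler_pdivrMr//; exact: Cr.
rewrite /gap_frac.
set T : R := (\sum_(b n <= m < b n.+1) count_mem g _)%N%:R.
set S : R := (\sum_(b n <= m < b n.+1) size _)%N%:R.
(* A good m contributes at most eps / 2 times its number of gaps. A bad one contributes at most n,
   since its count and p times its number of gaps both lie between 0 and n. *)
have TS : `|T - p * S| <= eps / 2 * S + n%:R * B.
  rewrite /T /S /B !natr_sum !mulr_sumr -sumrB -big_split/=.
  apply: le_trans (ler_norm_sum _ _ _) _; rewrite !big_nat.
  apply: ler_sum => m nm.
  have := size_gaps_dec n m n0 nm.
  have := count_size (pred1 g) (gaps (dec m)); rewrite -!(ler_nat R) => h1 h2.
  have z0 : 0 <= (size (gaps (dec m)))%:R :> R by [].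
  have k0 : 0 <= (count_mem g (gaps (dec m)))%:R :> R by [].
  rewrite /bad /=; case: (boolP (good_gaps _ _ _ _ _ _ _ _)) => [|_] /=.
    by rewrite mulr0 addr0 => /andP[].
  rewrite mulr1 -[leLHS]add0r lerD ?mulr_ge0 ?divr_ge0 ?(ltW eps0)//.
  by rewrite ler_norml; apply/andP; split; nra.
have SB : delta * n%:R * (c - B) <= S.
  have -> : c - B = \sum_(b n <= m < b n.+1) (1 - (bad m)%:R).
    by rewrite sumrB -natr_sum sumr_const_nat.
  rewrite /S natr_sum mulr_sumr !big_nat.
  apply: ler_sum => m nm; rewrite /bad /=.
  case: (boolP (good_gaps _ _ _ _ _ _ _ _)) => [|_] /=.
    by rewrite subr0 mulr1 => /andP[].
  by rewrite subrr mulr0.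
have B2 : B <= c / 2.
  by apply: le_trans Bc _; rewrite mulrC ler_wpM2l ?(ltW c0)//; lra.
have dn : 0 < delta * n%:R by exact: mulr_gt0.
have SL : delta * n%:R * (c / 2) <= S.
  by apply: le_trans SB; rewrite ler_wpM2l ?(ltW dn)//; lra.
have S0 : 0 < S by apply: lt_le_trans SL; rewrite mulr_gt0// divr_gt0.
have nB : n%:R * B <= eps / 2 * S.
  apply: (@le_trans _ _ (eps / 2 * (delta * n%:R * (c / 2)))); last first.
    by rewrite ler_wpM2l// divr_ge0// ltW.
  have -> : eps / 2 * (delta * n%:R * (c / 2)) = n%:R * (eps * delta / 4 * c) by field.
  rewrite ler_wpM2l//; apply: le_trans Bc _; rewrite ler_wpM2r ?(ltW c0)//; lra.
rewrite distrC -[X in _ - X](mulfK (lt0r_neq0 S0)) -mulrBl normrM normfV (gtr0_norm S0).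
rewrite ler_pdivrMr//; lra.
Unshelve. all: by end_near.
Qed.

End GapFraction.

(** * Almost sure weak convergence *)

Section WeakConvergence.
Variable R : realType.

Lemma cvg_to_eq (u : nat -> R) (l l' : R) : l = l' -> u @ \oo --> l -> u @ \oo --> l'.
Proof. by move=> ->. Qed.

Lemma sum_seq_count (f : nat -> R) (s : seq nat) K :
  \sum_(g <- s | (g < K)%N) f g = \sum_(0 <= g < K) (count_mem g s)%:R * f g.
Proof.
elim: s => [|a s IH].
  by rewrite big_nil big1// => g _; rewrite mul0r.
rewrite big_cons IH; under [RHS]eq_bigr => g _ do rewrite /= natrD mulrDl.
rewrite big_split/=; case: ifPn => aK.
  congr (_ + _); rewrite (bigD1_seq a) ?iota_uniq ?mem_index_iota//= eqxx mul1r.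
  by rewrite big1 ?addr0// => g ga; rewrite eq_sym (negbTE ga) mul0r.
rewrite [X in X + _](_ : _ = 0) ?add0r// big_nat big1// => g gK.
have -> : (a == g) = false by apply/negP => /eqP ag; move: aK; rewrite ag; case/andP: gK => _ ->.
by rewrite mul0r.
Qed.

(* Scheffe: mass that the empirical measures put beyond K is the complement of
   the mass below K, so pointwise convergence to a probability upgrades to weak
   convergence. *)
Lemma empirical_mean_cvg (gs : nat -> seq nat) (p f : nat -> R) (M : R) :
  (forall g, 0 <= p g) -> series p @ \oo --> (1 : R) ->
  (forall g, `|f g| <= M) ->
  (\forall n \near \oo, (0 < size (gs n))%N) ->
  (forall g, (fun n => (count_mem g (gs n))%:R / (size (gs n))%:R : R) @ \oo --> p g) ->
  (fun n => (size (gs n))%:R^-1 * \sum_(g <- gs n) f g) @ \oo -->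
    limn (fun N => \sum_(0 <= g < N) p g * f g).
Proof.
move=> p0 p1 fM sz cnt.
have M0 : 0 <= M by apply: le_trans (fM 0%N).
have cS : cvgn (series (fun g => p g * f g)).
  apply: normed_cvg; apply: (@series_le_cvg _ _ (fun g => M * p g)) => [g|g|g|] /=.
  - by [].
  - by rewrite mulr_ge0.
  - by rewrite normrM (ger0_norm (p0 g)) mulrC ler_wpM2r.
  - have -> : (fun g => M * p g) = M *: p by apply/funext.
    by apply: is_cvg_seriesZ; apply/cvg_ex; exists 1.
pose L := limn (series (fun g => p g * f g)).
rewrite -/(series (fun g => p g * f g)) -/L.
apply/cvgrPdist_le => /= eps eps0.
have e0 : 0 < eps / 3 by rewrite divr_gt0.
(* Dividing by M + 1 instead of M covers M = 0. *)
have M10 : 0 < M + 1 by rewrite ltr_wpDl.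
have e1 : 0 < eps / 3 / (M + 1) by rewrite divr_gt0.
have tail : \forall K \near \oo, `|1 - series p K| <= eps / 3 / (M + 1).
  by move/cvgrPdist_le : p1; apply.
have Lk : \forall K \near \oo, `|L - series (fun g => p g * f g) K| <= eps / 3.
  by move/cvgrPdist_le : cS; apply.
near \oo => K.
have tK : `|1 - series p K| <= eps / 3 / (M + 1) by near: K.
have LK : `|L - series (fun g => p g * f g) K| <= eps / 3 by near: K.
have dev0 k : (fun n => \sum_(0 <= g < k)
    `|(count_mem g (gs n))%:R / (size (gs n))%:R - p g|) @ \oo --> (0 : R).
  elim: k => [|k IH].
    under eq_fun do rewrite big_geq//.
    exact: cvg_cst.
  under eq_fun do rewrite big_nat_recr//=.
  have dk : (fun n => `|(count_mem k (gs n))%:R / (size (gs n))%:R - p k|) @ \oo --> (0 : R).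
    apply/cvgrPdist_le => /= e' e'0; have /cvgrPdist_le/(_ e' e'0) := cnt k.
    by apply: filterS => n; rewrite sub0r normrN normr_id distrC.
  by apply: (cvg_to_eq _ _ _ (addr0 0)); apply: cvgD.
have e2 : 0 < eps / 3 / (2 * (M + 1)) by rewrite divr_gt0 ?mulr_gt0.
have devK : \forall n \near \oo, `|\sum_(0 <= g < K)
    `|(count_mem g (gs n))%:R / (size (gs n))%:R - p g| | <= eps / 3 / (2 * (M + 1)).
  by have /cvgr0_norm_le := dev0 K; apply.
near=> n.
have s0 : (0 < size (gs n))%N by near: n.
have : `|\sum_(0 <= g < K) `|(count_mem g (gs n))%:R / (size (gs n))%:R - p g| |
  <= eps / 3 / (2 * (M + 1)) by near: n.
set s := gs n in s0 *; set z : R := (size s)%:R.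
set D := \sum_(0 <= g < K) _ => DK.
have z0 : 0 < z by rewrite ltr0n.
pose fr g : R := (count_mem g s)%:R / z.
have D0 : 0 <= D by apply: sumr_ge0 => g _.
rewrite ger0_norm// in DK.
rewrite (bigID (fun g => (g < K)%N))/= sum_seq_count mulrDr.
set rest := \sum_(g <- s | ~~ _) _.
have restE : `|z^-1 * rest| <= M * (1 - \sum_(0 <= g < K) fr g).
  have -> : 1 - \sum_(0 <= g < K) fr g = z^-1 * \sum_(g <- s | ~~ (g < K)%N) 1.
    apply/eqP; rewrite subr_eq eq_sym; apply/eqP.
    have -> : \sum_(0 <= g < K) fr g = z^-1 * \sum_(g <- s | (g < K)%N) 1.
      rewrite sum_seq_count mulr_sumr; apply: eq_bigr => g _.
      by rewrite /fr mulr1 mulrC.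
    have zE : z = \sum_(g <- s | (g < K)%N) 1 + \sum_(g <- s | ~~ (g < K)%N) 1.
      transitivity (\sum_(g <- s) (1 : R)).
        by rewrite big_const_seq count_predT iter_addr_0.
      by rewrite (bigID (fun g => (g < K)%N)).
    by rewrite -mulrDr addrC -zE mulVf// gt_eqF.
  rewrite normrM (gtr0_norm (_ : 0 < z^-1)) ?invr_gt0// mulrCA ler_wpM2l ?invr_ge0 ?(ltW z0)//.
  rewrite mulr_sumr; apply: le_trans (ler_norm_sum _ _ _) _.
  by apply: ler_sum => g _; rewrite mulr1.
have main : `|z^-1 * (\sum_(0 <= g < K) (count_mem g s)%:R * f g)
    - series (fun g => p g * f g) K| <= M * D.
  rewrite mulr_sumr /series/= -sumrB /D mulr_sumr.
  apply: le_trans (ler_norm_sum _ _ _) _; apply: ler_sum => g _.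
  have -> : z^-1 * ((count_mem g s)%:R * f g) - p g * f g = f g * ((count_mem g s)%:R / z - p g).
    by rewrite mulrBr; congr (_ - _); ring.
  by rewrite normrM ler_wpM2r.
have frp : 1 - \sum_(0 <= g < K) fr g <= `|1 - series p K| + D.
  have -> : 1 - \sum_(0 <= g < K) fr g = (1 - series p K) + \sum_(0 <= g < K) (p g - fr g).
    by rewrite sumrB /series/=; ring.
  rewrite lerD ?ler_norm//; apply: ler_sum => g _.
  by apply: le_trans (ler_norm _) _; rewrite distrC.
have MD : M * D <= eps / 3 / 2.
  apply: (@le_trans _ _ ((M + 1) * D)); first by rewrite ler_wpM2r// lerDl.
  rewrite mulrC -ler_pdivlMr//; apply: le_trans DK _.
  by rewrite le_eqVlt; apply/orP; left; apply/eqP; field; rewrite gt_eqF.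
have Mt : M * `|1 - series p K| <= eps / 3.
  apply: (@le_trans _ _ ((M + 1) * `|1 - series p K|)); first by rewrite ler_wpM2r// lerDl.
  by rewrite mulrC -ler_pdivlMr.
have Mf : M * (1 - \sum_(0 <= g < K) fr g) <= M * (`|1 - series p K| + D) by rewrite ler_wpM2l.
rewrite mulrDr in Mf.
(* The error budget: the tail of the limit series takes eps/3, the discrepancy M D below K takes
   eps/6, and the empirical tail takes eps/3 for the limit mass beyond K plus another M D. *)
set A := z^-1 * _ in main *; set B := z^-1 * _ in restE *.
set S := series _ K in main LK *.
have -> : L - (A + B) = (L - S) - (A - S) - B by ring.
apply: le_trans (ler_normB _ _) _.
apply: le_trans (lerD (ler_normB _ _) (lexx _)) _.
lra.
Unshelve. all: by end_near.
Qed.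

End WeakConvergence.

(** The series telescopes: x^(n+5) = x^n (1 - x) = x^n - x^(n+1). *)
Lemma limit_gap_prob_sum (R : realType) (x : R) : 0 < x < 1 -> x + x ^+ 5 = 1 ->
  series (limit_gap_prob R x) @ \oo --> (1 : R).
Proof.
move=> /andP[x0 x1] x5.
have y0 : 1 - x != 0 by rewrite subr_eq0 gt_eqF.
have sE n : series (limit_gap_prob R x) (n + 5)%N = 1 - geometric 1 x n.
  rewrite /series/=; elim: n => [|n IH].
    rewrite !big_nat_recr ?big_geq//= /limit_gap_prob/= !mul0r !addr0 expr0.
    by rewrite mulr1 subrr.
  rewrite addSn big_nat_recr//= IH /limit_gap_prob addnS ltnS (leq_trans _ (leq_addl _ _))//.
  rewrite /geometric/= !mul1r -addnS exprD (exprS x n).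
  have -> : x ^+ 5 = 1 - x by rewrite -x5 addrC addKr.
  by ring.
rewrite -(cvg_shiftn 5); apply: (@cvg_trans _ ((fun n => 1 - geometric 1 x n) @ \oo)).
  by apply: near_eq_cvg; apply: nearW => n; rewrite -sE.
have g0 : geometric 1 x @ \oo --> (0 : R) by apply: cvg_geometric; rewrite gtr0_norm.
by apply: (cvg_to_eq _ _ _ _ (subr0 1)); apply: cvgB => //; exact: cvg_cst.
Qed.

(** * Almost sure avoidance of rare events *)

Section BorelCantelli.
Context (R : realType) (b : nat -> nat) (d : measure_display) (Omega : measurableType d)
  (P : probability Omega R) (Z : nat -> Omega -> nat).
Hypotheses (mZ : forall n m, measurable (Z n @^-1` [set m]))
  (distZ : forall n m : nat, (1 <= n)%N ->
    P (Z n @^-1` [set m]) =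
    (if (b n <= m < b n.+1)%N then ((b n.+1 - b n)%N%:R^-1)%:E else 0%E)).

(** [Z n] takes countably many values, and each one outside the interval has probability 0. *)
Lemma ae_in_interval : {ae P, forall w, forall n, (0 < n)%N -> (b n <= Z n w < b n.+1)%N}.
Proof.
apply: ae_foralln => n.
have [->|n0] := posnP n; first exact: aeW.
pose F m := if (b n <= m < b n.+1)%N then set0 else Z n @^-1` [set m].
apply: (@negligibleS _ _ _ P (\bigcup_m F m)); last first.
  apply: negligible_bigcup => m; rewrite /F; case: ifPn => [_|nm]; first exact: negligible_set0.
  by apply/negligibleP => //; apply: (etrans (distZ n m n0)); rewrite (negbTE nm).
move=> w /= h; by exists (Z n w) => //; rewrite /F; case: ifPn.
Qed.

Lemma ae_rare_eventually (E : nat -> pred nat) : rare R b E ->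
  {ae P, forall w, exists N, forall n, (N <= n)%N -> ~~ E n (Z n w)}.
Proof.
move=> [C [r [C0 /andP[r0 r1] Er]]].
(* [F n] keeps only values in I_n, hence is a finite union of level sets; [ae_in_interval] accounts
   for the other values. Index 0 is set aside because the law of [Z n] is given for n >= 1. *)
pose G n i := if (b n <= i)%N && E n i then Z n @^-1` [set i] else set0.
pose F n := if n is 0%N then set0 else \big[setU/set0]_(i < b n.+1) G n i.
have mG n i : measurable (G n i) by rewrite /G; case: ifP.
have mF n : measurable (F n).
  by case: n => [|n]; [exact: measurable0|apply: bigsetU_measurable => i _; exact: mG].
have PF n : (P (F n) <= (C * r ^+ n)%:E)%E.
  case: n => [|n]; first by rewrite /F measure0 lee_fin mulr_ge0 ?exprn_ge0 ?(ltW r0).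
  apply: (@le_trans _ _ (freq R b n.+1 (E n.+1))%:E); last by rewrite lee_fin.
  apply: le_trans (Boole_inequality _ (fun i _ => mG n.+1 i)) _.
  rewrite (eq_bigr (fun i : 'I__ => (((b n.+1 <= i)%N && E n.+1 i)%:R / (b n.+2 - b n.+1)%N%:R)%:E)); last first.
    move=> i _; rewrite /G; case: ifPn => h; last by rewrite measure0 mul0r.
    apply: (etrans (distZ n.+1 i isT)).
    by rewrite mul1r ltn_ord andbT; move/andP: h => [-> _].
  rewrite sumEFin lee_fin -mulr_suml ler_wpM2r ?invr_ge0// -natr_sum ler_nat.
  rewrite -(big_mkord predT (fun i => nat_of_bool ((b n.+1 <= i)%N && E n.+1 i))).
  have [bb|bb] := leqP (b n.+1) (b n.+2); last first.
    rewrite big_nat_cond big1// => i /andP[/andP[_ ib] _].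
    by rewrite leqNgt (ltn_trans ib bb).
  rewrite (big_cat_nat (n := b n.+1))//= big_nat_cond big1 ?add0n; last first.
    by move=> i /andP[/andP[_ ib] _]; rewrite leqNgt ib.
  rewrite !big_nat; apply: leq_sum => i /andP[-> _]; exact: leqnn.
have sumF : (\sum_(n <oo) P (F n) < +oo)%E.
  apply: (@le_lt_trans _ _ (C / (1 - r))%:E); last exact: ltry.
  apply: lime_le; first by apply: is_cvg_nneseries => n _ _; exact: measure_ge0.
  apply: nearW => n.
  apply: (@le_trans _ _ (\sum_(0 <= i < n) (C * r ^+ i)%:E)%E).
    by apply: lee_sum => i _; exact: PF.
  have y0 : 0 < 1 - r by rewrite subr_gt0.
  rewrite sumEFin lee_fin.
  have := @geometric_seriesE R C r (negbT (lt_eqF r1)).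
  move=> /(congr1 (fun u => u n)) /=; rewrite /series/= => ->.
  rewrite ler_wpM2r ?invr_ge0 ?(ltW y0)// ler_piMr// lerBlDr lerDl.
  by rewrite exprn_ge0 ?(ltW r0).
have lim0 : {ae P, forall w, ~ lim_sup_set F w}.
  exists (lim_sup_set F); split.
  - by apply: bigcap_measurable => // k _; apply: bigcup_measurable => j _; exact: mF.
  - exact: lim_sup_set_cvg0.
  - by move=> w; apply: contrapT.
move: ae_in_interval lim0; apply: filterS2 => w inI.
(* By contraposition: occurrences of E beyond every bound put w in the limsup set. Taking [maxn k 1]
   avoids index 0. *)
apply: contra_notP => nE k _ /=.
have [j kj Ej] : exists2 j, (maxn k 1 <= j)%N & E j (Z j w).
  apply: contrapT => nex; apply: nE; exists (maxn k 1) => j kj.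
  by apply/negP => Ej; apply: nex; exists j.
exists j; first by rewrite /=; lia.
case: j kj Ej => [|j] kj Ej; first by lia.
have /andP[h1 h2] := inI j.+1 isT.
rewrite /F -bigcup_mkord; exists (Z j.+1 w) => //.
by rewrite /G h1 Ej.
Qed.

End BorelCantelli.

(** * The two sequences *)

Section DeterminedSequences.
Local Open Scope nat_scope.

(** At a first index of disagreement the smaller value would be decomposable for the other sequence,
    hence for its own, the earlier terms being equal. This identifies a and q with explicit
    recursive sequences. *)
Lemma min_nondec_unique (dec : (nat -> nat) -> nat -> nat -> Prop) (u v : nat -> nat) :
  (forall f g i m, (forall j, 0 < j < i -> f j = g j) -> dec f i m -> dec g i m) ->
  (forall i, 0 < i -> [/\ 0 < u i, ~ dec u i (u i) & forall m, 0 < m < u i -> dec u i m]) ->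
  (forall i, 0 < i -> [/\ 0 < v i, ~ dec v i (v i) & forall m, 0 < m < v i -> dec v i m]) ->
  forall i, 0 < i -> u i = v i.
Proof.
move=> ext hu hv i; have [k] := ubnP i; elim: k i => // k IH i ik i0.
have uv j : 0 < j < i -> u j = v j by move=> /andP[j0 ji]; apply: IH; lia.
have vu j : 0 < j < i -> v j = u j by move/uv.
have [u0 un ud] := hu i i0; have [v0 vn vd] := hv i i0.
case: (ltngtP (u i) (v i)) => // h.
- by case: un; apply: (ext v) => //; apply: vd; rewrite u0.
- by case: vn; apply: (ext u) => //; apply: ud; rewrite v0.
Qed.

(* The junk value 1 at index 0 makes the recursion start at index 5. *)
Fixpoint gen_ref (n : nat) : nat :=
  match n with
  | 0 => 1 | 1 => 1 | 2 => 2 | 3 => 3 | 4 => 4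
  | S ((S (S (S (S k)))) as m) => gen_ref m + gen_ref k
  end.

(** The value 7 at index 6 is prescribed: the recursion would give 5 + 1 = 6, but 6 = q_4 + q_2 is
    FQ-legal. *)
Fixpoint fq_ref (n : nat) : nat :=
  match n with
  | 0 => 1 | 1 => 1 | 2 => 2 | 3 => 3 | 4 => 4 | 5 => 5 | 6 => 7
  | S ((S (S (S (S k)))) as m) => fq_ref m + fq_ref k
  end.

Lemma gen_refS n : 4 < n -> gen_ref n.+1 = gen_ref n + gen_ref (n - 4).
Proof. by case: n => [|[|[|[|n]]]] // _; rewrite !subSS subn0. Qed.

Lemma fq_refS n : 5 < n -> fq_ref n.+1 = fq_ref n + fq_ref (n - 4).
Proof. by case: n => [|[|[|[|[|[|n]]]]]] // _; rewrite !subSS subn0. Qed.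

Lemma gen_ref_mono n : 0 < gen_ref n <= gen_ref n.+1.
Proof.
have [k] := ubnP n; elim: k n => // k IH n nk.
have [n4|n4] := ltnP 4 n; last by case: n n4 {nk} => [|[|[|[|[|n]]]]].
rewrite gen_refS// leq_addr andbT.
case: n nk n4 => // n nk n4; have /andP[h1 h2] := IH n (ltac:(lia)).
exact: leq_trans h2.
Qed.

Lemma fq_ref_mono n : 0 < fq_ref n <= fq_ref n.+1.
Proof.
have [k] := ubnP n; elim: k n => // k IH n nk.
have [n4|n4] := ltnP 5 n; last by case: n n4 {nk} => [|[|[|[|[|[|n]]]]]].
rewrite fq_refS// leq_addr andbT.
case: n nk n4 => // n nk n4; have /andP[h1 h2] := IH n (ltac:(lia)).
exact: leq_trans h2.
Qed.

Lemma gen_ref_lag5 : lag5_seq gen_ref.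
Proof.
split=> // n n0; last by rewrite gen_refS//; lia.
have [n4|n4] := ltnP 4 n; last by case: n n0 n4 => [|[|[|[|[|n]]]]].
rewrite gen_refS//.
case: n n0 n4 => [|[|[|[|n]]]] // _ _; rewrite !subSS subn0.
have /andP[h0 h1] := gen_ref_mono n; have /andP[_ h2] := gen_ref_mono n.+1.
have /andP[_ h3] := gen_ref_mono n.+2; have /andP[_ h4] := gen_ref_mono n.+3.
lia.
Qed.

Lemma fq_ref_lag5 : lag5_seq fq_ref.
Proof.
split=> // n n0; last exact: fq_refS.
have [n4|n4] := ltnP 5 n; last by case: n n0 n4 => [|[|[|[|[|[|n]]]]]].
rewrite fq_refS//.
case: n n0 n4 => [|[|[|[|n]]]] // _ _; rewrite !subSS subn0.
have /andP[h0 h1] := fq_ref_mono n; have /andP[_ h2] := fq_ref_mono n.+1.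
have /andP[_ h3] := fq_ref_mono n.+2; have /andP[_ h4] := fq_ref_mono n.+3.
lia.
Qed.

Lemma lag5_pos b : lag5_seq b -> forall n, 0 < n -> b n < b n.+1.
Proof. by case=> _ h _ n /h/andP[]. Qed.

Lemma lag5_b1 b : lag5_seq b -> b 1 = 1.
Proof. by case. Qed.

Lemma lag5_ext b b' : (forall i, 0 < i -> b i = b' i) -> lag5_seq b -> lag5_seq b'.
Proof.
move=> bb [h1 h2 h3]; split.
- by rewrite -bb.
- by move=> n n0; rewrite -!bb//; exact: h2.
- by move=> n n5; rewrite -!bb ?h3//; lia.
Qed.

Definition gen_sorted : seq nat -> bool := sorted (fun x y => y + 5 <= x).

(** * Generacci legal decompositions are the greedy ones *)

Section Generacci.
Variable a : nat -> nat.
Hypotheses (ha : lag5_seq a) (a5 : forall n, 4 < n -> a n.+1 = a n + a (n - 4))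
  (asmall : forall n, 0 < n <= 4 -> a n.+1 = (a n).+1).

(** The second index is at most l - 5, so the tail stays below a (l - 4), and a l + a (l - 4) = a (l
    + 1). *)
Lemma gen_sum_lt l L : gen_sorted (l :: L) -> all (fun j => 0 < j) (l :: L) ->
  sumn (map a (l :: L)) < a l.+1.
Proof.
elim: L l => [|y L IH] l.
  by move=> _ /andP[l0 _]; rewrite /= addn0; exact: (lag5_pos _ ha).
move=> /= /andP[yl yL] /andP[l0 yL0].
have y0 : 0 < y by case/andP: yL0.
have := IH y yL yL0; rewrite /= (a5 l); last by lia.
have : a y.+1 <= a (l - 4) by apply: (seq_homo _ (lag5_pos _ ha)); lia.
lia.
Qed.

(** By [gen_sum_lt] the sum lies in [a l, a (l + 1)) for the leading index l, which greedy therefore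
    picks first. *)
Lemma greedy_gen L : gen_sorted L -> all (fun l => 0 < l) L -> greedy a (sumn (map a L)) = L.
Proof.
elim: L => // l L IH lL lL0; have lt := gen_sum_lt _ _ lL lL0.
have [l0 L0] : 0 < l /\ all (fun l => 0 < l) L by apply/andP.
rewrite (greedyE _ (lag5_b1 _ ha) (lag5_pos _ ha) l)//; last by rewrite lt /= leq_addr.
by rewrite /= addKn IH// /gen_sorted (path_sorted lL).
Qed.

(** A greedy step at l > 4 leaves a remainder below a (l - 4), decomposed with indices at most l -
    5. For l <= 4 the interval is the singleton of a l. *)
Lemma gen_dec_ex i m : 0 < i -> m < a i ->
  exists L, gen_legal_dec a L m /\ all (fun l => l < i) L.
Proof.
have a1 := lag5_b1 _ ha; have ainc := lag5_pos _ ha.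
have [k] := ubnP m; elim: k m i => // k IH m i mk i0 mi.
case: (posnP m) => [->|m0]; first by exists [::]; split.
have [l l0 /andP[lm ml]] := interval_ex _ a1 ainc m m0.
have li : l < i.
  rewrite ltnNge; apply/negP => il; have := seq_homo _ ainc i l i0 il; lia.
have al : l <= a l := seq_ge _ a1 ainc l l0.
have [l4|l4] := leqP l 4.
  exists [:: l]; split; last by rewrite /= li.
  by split; rewrite //= ?l0// addn0; have := asmall l; lia.
have [|||L [[Ls L0 Lsum] Lb]] := IH (m - a l) (l - 4); [lia|lia| |].
  by rewrite ltn_subLR// -a5//; lia.
exists (l :: L); split; last first.
  rewrite /= li; apply: sub_all Lb => z; lia.
split; [|by rewrite /= l0|by rewrite /= Lsum subnKC].
case: L Ls Lb {L0 Lsum} => // y L /= -> /andP[yl _]; rewrite andbT; lia.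
Qed.

End Generacci.

Lemma gen_ref_small n : 0 < n <= 4 -> gen_ref n.+1 = (gen_ref n).+1.
Proof. by case: n => [|[|[|[|[|n]]]]]. Qed.

Lemma gen_seqE a : Gen41_seq a -> forall i, 0 < i -> a i = gen_ref i.
Proof.
move=> hA; apply: (min_nondec_unique
  (fun f i m => exists L, gen_legal_dec f L m /\ all (fun l => l < i) L)) => //.
- move=> f g i m fg [L [[Ls L0 Lm] Li]]; exists L; split => //; split=> //.
  rewrite -Lm; congr sumn; apply/eq_in_map => j jL; apply/esym/fg.
  by rewrite (allP L0 _ jL) (allP Li _ jL).
- move=> i i0; have hr := gen_ref_lag5; split.
  + by case/andP: (gen_ref_mono i).
  + move=> [L [[Ls L0 Lm] Li]]; case: L => [|l L] in Ls L0 Lm Li *.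
      by case/andP: (gen_ref_mono i); rewrite -Lm.
    have := gen_sum_lt _ hr gen_refS l L Ls L0.
    have : gen_ref l.+1 <= gen_ref i.
      apply: (seq_homo _ (lag5_pos _ hr)) => //.
      by case/andP: Li.
    by rewrite Lm; lia.
  + by move=> m /andP[_ mi]; apply: (gen_dec_ex _ hr gen_refS gen_ref_small).
Qed.

Lemma gen_seq_lag5 a : Gen41_seq a -> lag5_seq a.
Proof.
move=> hA; apply: (lag5_ext gen_ref) gen_ref_lag5 => i i0.
by rewrite (gen_seqE a hA).
Qed.

Lemma gen_dec_greedy a decA : Gen41_seq a ->
  (forall m, 0 < m -> gen_legal_dec a (decA m) m) ->
  forall m, 0 < m -> decA m = greedy a m.
Proof.
move=> hA hdec m m0; have [Ls L0 Lm] := hdec m m0.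
rewrite -[in RHS]Lm greedy_gen//; first exact: gen_seq_lag5.
by move=> n n3; rewrite !(gen_seqE a hA) ?gen_refS//; lia.
Qed.

(** * Quilt numbers are not FQ-legal sums of earlier ones *)

Section QuiltSums.

Variable p : nat -> bool.
Hypotheses (pd : forall x d, d \in [:: 1; 3; 4] -> p x -> p (x + d) = false)
  (p13 : p 1 -> p 3 = false).

(** Encoding the index set by its indicator p lets the proofs decide memberships one at a time from
    the top index down. *)
Fixpoint quilt_sum (k : nat) : nat :=
  if k is k'.+1 then quilt_sum k' + p k * fq_ref k else 0.

Let d1 x : p x -> p x.+1 = false. Proof. by rewrite -addn1; apply: pd. Qed.
Let d3 x : p x -> p x.+3 = false. Proof. by rewrite -addn3; apply: pd. Qed.
Let d4 x : p x -> p x.+4 = false. Proof. by rewrite -addn4; apply: pd. Qed.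

(** The Padovan relation belongs to the factor y^3 - y - 1 of y^5 - y^4 - 1. The initial values
    satisfy it, and two earlier instances of it combine with the lag-5 step. *)
Lemma fq_ref_padovan n : 0 < n -> fq_ref n.+4 = fq_ref n.+2 + fq_ref n.+1.
Proof.
have [k] := ubnP n; elim: k n => // k IH [|[|[|n]]] // nk _.
have h := IH n.+2 (ltac:(lia)) isT; have h' := IH n.+1 (ltac:(lia)) isT.
by rewrite [LHS]fq_refS// !subSS subn0; lia.
Qed.

Lemma fq_ref_leq i j : i <= j -> fq_ref i <= fq_ref j.
Proof.
by apply: (homo_leq leqnn leq_trans) => n; case/andP: (fq_ref_mono n).
Qed.

Lemma quilt_sumS k : quilt_sum k.+1 = quilt_sum k + p k.+1 * fq_ref k.+1.
Proof. by []. Qed.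

Lemma quilt_sum_in k : p k.+1 -> quilt_sum k.+1 = quilt_sum k + fq_ref k.+1.
Proof. by rewrite quilt_sumS => ->; rewrite mul1n. Qed.

Lemma quilt_sum_out k : p k.+1 = false -> quilt_sum k.+1 = quilt_sum k.
Proof. by rewrite quilt_sumS => ->; rewrite addn0. Qed.

Lemma quilt_sum_lt k : quilt_sum k < fq_ref k.+3.
Proof.
have [n] := ubnP k; elim: n k => // n IH k kn.
have [k7|k7] := ltnP k 7.
  have e1 := d1 1; have e2 := d1 2; have e3 := d1 3; have e4 := d1 4; have e5 := d1 5.
  have f1 := d3 1; have f2 := d3 2; have f3 := d3 3; have g1 := d4 1; have g2 := d4 2.
  move: e1 e2 e3 e4 e5 f1 f2 f3 g1 g2 p13.
  by case: k k7 {kn} => [|[|[|[|[|[|[|k]]]]]]] // _ /=;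
     case: (p 1) (p 2) (p 3) (p 4) (p 5) (p 6) => [] [] [] [] [] [] //= *; lia.
case: k kn k7 => [|[|[|[|[|[|[|k]]]]]]] // kn _.
have pad := fq_ref_padovan k.+4.+2 isT; have pad' := fq_ref_padovan k.+4 isT.
have le1 : fq_ref k.+4.+1 <= fq_ref k.+4.+2 := fq_ref_leq _ _ (leqnSn _).
have le2 : fq_ref k.+3 <= fq_ref k.+4.+2 by apply: fq_ref_leq; lia.
have le3 : fq_ref k.+4.+1 <= fq_ref k.+4.+4 by apply: fq_ref_leq; lia.
have := IH k.+2 (ltac:(lia)); have := IH k (ltac:(lia)); have := IH k.+4.+2 (ltac:(lia)).
have q9 : fq_ref k.+4.+4.+1 <= fq_ref k.+4.+4.+2 by apply: fq_ref_leq; lia.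
case p7 : (p k.+4.+3); last by rewrite (quilt_sum_out _ p7); lia.
have p6 : p k.+4.+2 = false by apply/negP => /d1; rewrite p7.
have p4 : p k.+4 = false by apply/negP => /d3; rewrite p7.
have p3 : p k.+3 = false by apply/negP => /d4; rewrite p7.
rewrite (quilt_sum_in _ p7) (quilt_sum_out _ p6).
case p5 : (p k.+4.+1); last first.
  by rewrite (quilt_sum_out _ p5) (quilt_sum_out _ p4) (quilt_sum_out _ p3); lia.
have p2 : p k.+2 = false by apply/negP => /d3; rewrite p5.
have p1 : p k.+1 = false by apply/negP => /d4; rewrite p5.
rewrite (quilt_sum_in _ p5) (quilt_sum_out _ p4) (quilt_sum_out _ p3).
by rewrite (quilt_sum_out _ p2) (quilt_sum_out _ p1); lia.
Qed.

(** A finite check, in which 1 and 3 must not occur together because q_1 + q_3 = q_4. *)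
Lemma quilt_sum_small_neq k : k < 9 -> quilt_sum k <> fq_ref k.+1.
Proof.
move=> k9.
have e1 := d1 1; have e2 := d1 2; have e3 := d1 3; have e4 := d1 4; have e5 := d1 5.
have e6 := d1 6; have e7 := d1 7.
have f1 := d3 1; have f2 := d3 2; have f3 := d3 3; have f4 := d3 4; have f5 := d3 5.
have g1 := d4 1; have g2 := d4 2; have g3 := d4 3; have g4 := d4 4.
move: e1 e2 e3 e4 e5 e6 e7 f1 f2 f3 f4 f5 g1 g2 g3 g4 p13.
by case: k k9 => [|[|[|[|[|[|[|[|[|k]]]]]]]]] // _ /=;
   case: (p 1) (p 2) (p 3) (p 4) => [] [] [] [] //=;
   case: (p 5) (p 6) (p 7) (p 8) => [] [] [] [] //= *; lia.
Qed.

(** Once the top memberships are decided, either the sum misses the target by size, or cancelling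
    leading terms leaves the same equation at a smaller k. *)
Lemma quilt_sum_neq k : quilt_sum k <> fq_ref k.+1.
Proof.
have [n] := ubnP k; elim: n k => // n IH k kn.
have [k9|k9] := ltnP k 9; first exact: quilt_sum_small_neq.
case: k kn k9 => [|[|[|[|[|[|[|[|[|k]]]]]]]]] // kn _ eqk.
have lt3 := quilt_sum_lt k.+3; have lt5 := quilt_sum_lt k.+4.+1.
have lt6 := quilt_sum_lt k.+4.+2.
have pad : fq_ref k.+4.+4.+2 = fq_ref k.+4.+4 + fq_ref k.+4.+3 by exact: fq_ref_padovan.
have lag : fq_ref k.+4.+4.+2 = fq_ref k.+4.+4.+1 + fq_ref k.+4.+1.
  by rewrite [LHS]fq_refS// !subSS subn0.
have lag7 : fq_ref k.+4.+3 = fq_ref k.+4.+2 + fq_ref k.+2.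
  by rewrite [LHS]fq_refS// !subSS subn0.
have q5 : fq_ref k.+4.+1 <= fq_ref k.+4.+2 by apply: fq_ref_leq.
have q9 : fq_ref k.+4.+4.+1 <= fq_ref k.+4.+4.+2 by apply: fq_ref_leq.
have q2 : 0 < fq_ref k.+2 by case/andP: (fq_ref_mono k.+2).
have q8 : 0 < fq_ref k.+4.+1 by case/andP: (fq_ref_mono k.+4.+1).
have IH4 := IH k.+4 (ltac:(lia)); have IH1 := IH k.+1 (ltac:(lia)).
case p9 : (p k.+4.+4.+1).
  have p8 : p k.+4.+4 = false by apply/negP => /d1; rewrite p9.
  have p6 : p k.+4.+2 = false by apply/negP => /d3; rewrite p9.
  have p5 : p k.+4.+1 = false by apply/negP => /d4; rewrite p9.
  move: eqk; rewrite (quilt_sum_in _ p9) (quilt_sum_out _ p8).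
  case p7 : (p k.+4.+3); first by rewrite (quilt_sum_in _ p7); lia.
  by rewrite (quilt_sum_out _ p7) (quilt_sum_out _ p6) (quilt_sum_out _ p5); lia.
(* As q_(k+10) = q_(k+8) + q_(k+7), the rest must equal q_(k+7) = q_(k+6) + q_(k+2): it is too small
   without k+6, and with k+6 this is the equation at k+1. *)
move: eqk; rewrite (quilt_sum_out _ p9); case p8 : (p k.+4.+4).
  have p7 : p k.+4.+3 = false by apply/negP => /d1; rewrite p8.
  have p5 : p k.+4.+1 = false by apply/negP => /d3; rewrite p8.
  have p4 : p k.+4 = false by apply/negP => /d4; rewrite p8.
  rewrite (quilt_sum_in _ p8) (quilt_sum_out _ p7).
  case p6 : (p k.+4.+2); last first.
    by rewrite (quilt_sum_out _ p6) (quilt_sum_out _ p5) (quilt_sum_out _ p4); lia.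
  have p3 : p k.+3 = false by apply/negP => /d3; rewrite p6.
  have p2 : p k.+2 = false by apply/negP => /d4; rewrite p6.
  rewrite (quilt_sum_in _ p6) (quilt_sum_out _ p5) (quilt_sum_out _ p4).
  by rewrite (quilt_sum_out _ p3) (quilt_sum_out _ p2); lia.
(* Without k+9 and k+8 the sum is too small by [quilt_sum_lt]. *)
rewrite (quilt_sum_out _ p8); case p7 : (p k.+4.+3); last first.
  by rewrite (quilt_sum_out _ p7); lia.
have p6 : p k.+4.+2 = false by apply/negP => /d1; rewrite p7.
by rewrite (quilt_sum_in _ p7) (quilt_sum_out _ p6); lia.
Qed.

Lemma quilt_sumE k : quilt_sum k = \sum_(1 <= l < k.+1 | p l) fq_ref l.
Proof.
elim: k => [|k IH]; first by rewrite big_geq.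
by rewrite quilt_sumS IH [in RHS]big_mkcond big_nat_recr//= -big_mkcond; case: (p _); rewrite ?mul1n.
Qed.

End QuiltSums.

Lemma fq_legal_sum_neq i L : 0 < i -> fq_legal L -> all (fun l => l < i) L ->
  sumn (map fq_ref L) <> fq_ref i.
Proof.
case: i => // k _ /and4P[Lu L0 Ld L13] Li.
have -> : sumn (map fq_ref L) = quilt_sum (mem L) k.
  rewrite quilt_sumE sumnE big_map -[RHS]big_filter; apply: perm_big.
  apply: uniq_perm => // [|l]; first by rewrite filter_uniq// iota_uniq.
  rewrite mem_filter mem_index_iota.
  apply/idP/andP => [lL|[]//]; split=> //.
  by rewrite (allP L0 _ lL) (allP Li _ lL).
apply: quilt_sum_neq => [x d d134 xL|L1]; last first.
  by apply/negP => L3; case/negP: L13; apply/andP.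
apply/negP => yL; have /orP[/eqP|] := allP (allP Ld _ xL) _ yL.
  by move=> xd; move: d134; rewrite -[d](addKn x) -xd subnn.
by rewrite /ndist subnDA subnn sub0n add0n addKn d134.
Qed.

Lemma fq_legal_cons l L : 5 < l -> fq_legal L -> all (fun j => j < l - 4) L ->
  fq_legal (l :: L).
Proof.
move=> l5 /and4P[Lu L0 Ld L13] Lb; apply/and4P; split.
- by rewrite /= Lu andbT; apply/negP => /(allP Lb); lia.
- by rewrite /= L0 andbT; lia.
- have far j : j \in L -> (ndist l j \notin [:: 1; 3; 4]) && (ndist j l \notin [:: 1; 3; 4]).
    by move=> /(allP Lb) jl; rewrite !inE /ndist; lia.
  apply/allP => i; rewrite inE => /orP[/eqP->|iL].
    rewrite /= eqxx /=; apply/allP => j /far/andP[-> _]; exact: orbT.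
  rewrite /=; have /andP[_ ->] := far i iL; rewrite orbT /=; exact: (allP Ld).
- rewrite !inE negb_and; move: L13; rewrite negb_and.
  by rewrite (ltn_eqF (leq_trans _ l5 : 1 < l)) ?(ltn_eqF (leq_trans _ l5 : 3 < l)).
Qed.

(** A greedy step at l > 5 leaves a remainder below q_(l-4), hence differences of at least 5. For l
    <= 5 the intervals contain only quilt numbers and 6 = q_4 + q_2. *)
Lemma fq_dec_ex i m : 0 < i -> m < fq_ref i -> has_fq_dec fq_ref i m.
Proof.
have a1 := lag5_b1 _ fq_ref_lag5; have ainc := lag5_pos _ fq_ref_lag5.
have [k] := ubnP m; elim: k m i => // k IH m i mk i0 mi.
case: (posnP m) => [->|m0]; first by exists [::]; split.
have [l l0 /andP[lm ml]] := interval_ex _ a1 ainc m m0.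
have li : l < i.
  rewrite ltnNge; apply/negP => il; have := seq_homo _ ainc i l i0 il; lia.
have al : l <= fq_ref l := seq_ge _ a1 ainc l l0.
have [l5|l5] := leqP l 5.
  have [e|e] := eqVneq (fq_ref l) m.
    by exists [:: l]; rewrite /= li addn0; split=> //; rewrite /fq_legal /= l0 eqxx !inE; lia.
  have [l5' m6] : l = 5 /\ m = 6.
    by case: l l0 l5 lm ml e {li al} => [|[|[|[|[|[|l]]]]]] //= _ _ lm ml /eqP e; lia.
  by exists [:: 4; 2]; rewrite m6 /=; split=> //; lia.
have [|||L [Ll Lb Ls]] := IH (m - fq_ref l) (l - 4); [lia|lia| |].
  by rewrite ltn_subLR// -fq_refS.
exists (l :: L); split; first exact: fq_legal_cons.
- rewrite /= li; apply: sub_all Lb => z; lia.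
- by rewrite /= Ls subnKC.
Qed.

Lemma fq_seqE q : FQ_seq q -> forall i, 0 < i -> q i = fq_ref i.
Proof.
move=> [q1 hq]; apply: (min_nondec_unique has_fq_dec) => [f g i m fg|i i0|i i0].
- move=> [L [Ll Li Lm]]; exists L; split=> //; rewrite -Lm.
  congr sumn; apply/eq_in_map => j jL; apply/esym/fg.
  by case/and4P: Ll => _ L0 _ _; rewrite (allP L0 _ jL) (allP Li _ jL).
- case: i i0 => [|[|i]] // _; last exact: hq.
  rewrite q1; split=> // [[L [/and4P[_ L0 _ _] Li Lm]]|m]; last by lia.
  case: L L0 Li Lm => //= l L /andP[l0 _] /andP[l1 _]; lia.
- split.
  + by case/andP: (fq_ref_mono i).
  + by move=> [L [Ll Li]]; exact: fq_legal_sum_neq.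
  + by move=> m /andP[_ mi]; exact: fq_dec_ex.
Qed.

Lemma fq_seq_lag5 q : FQ_seq q -> lag5_seq q.
Proof.
move=> hQ; apply: (lag5_ext fq_ref) fq_ref_lag5 => i i0.
by rewrite (fq_seqE q hQ).
Qed.

(** * Comparison of Greedy-6 with plain greedy *)

Section Greedy6.
Variable q : nat -> nat.
Hypothesis hQ : FQ_seq q.

Let qE := fq_seqE q hQ.
Let q1 : q 1 = 1 := lag5_b1 _ (fq_seq_lag5 q hQ).
Let qS : forall n, 0 < n -> q n < q n.+1 := lag5_pos _ (fq_seq_lag5 q hQ).

Lemma greedy_six : greedy q 6 = [:: 5; 1].
Proof.
by rewrite (greedyE q q1 qS 5)// ?qE//= (greedyE q q1 qS 1)// ?qE.
Qed.

(* Plain greedy ends 6 = q_5 + q_1 where Greedy-6 ends 6 = q_4 + q_2. *)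
Lemma g6_aux_greedy f m : 0 < m <= f ->
  (m = 6 /\ g6_aux q f m = [:: 4; 2]) \/
  [/\ head 0 (g6_aux q f m) = head 0 (greedy q m), g6_aux q f m != [::],
      size (g6_aux q f m) = size (greedy q m)
    & forall g, count_mem g (gaps (g6_aux q f m)) <= count_mem g (gaps (greedy q m)) + 2 /\
      count_mem g (gaps (greedy q m)) <= count_mem g (gaps (g6_aux q f m)) + 2].
Proof.
elim: f m => [|f IH] m /andP[m0 mf]; first by lia.
have [n n0 nm] := interval_ex _ q1 qS m m0.
have qn : n <= q n := seq_ge _ q1 qS n n0.
rewrite /= (fq_index_eq _ q1 qS n)// (gtn_eqF m0) (greedyE q q1 qS n)//.
case: eqP => [<-|qm].
  by right; rewrite subnn /greedy /=; split=> // g; rewrite addn2; split.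
case: eqP => [m6|m6]; first by left.
right; set x := m - q n.
have x0 : 0 < x by rewrite /x; lia.
have [|[x6 ->]|[hd ne sz cnt]] := IH x; first by rewrite x0 /x; lia.
  (* The last gaps are n - 4 and 2 instead of n - 5 and 4, so two entries change. *)
  rewrite x6 greedy_six; split=> // g; rewrite /gaps /=.
  by case: eqP; case: eqP; case: eqP; case: eqP => *; lia.
split=> //; first by rewrite /= sz.
move=> g; move: hd ne sz cnt.
(* Equal heads give both lists the same new first gap, so the slack 2 does not accumulate. *)
case: (g6_aux q f x) => // y s; case: (greedy q x) => // z t yz _ _ /(_ g).
have {yz}-> : y = z := yz.
by rewrite !gaps_cons2; move: (gaps _) (gaps _) => u v [c1 c2] /=; rewrite -!addnA !leq_add2l.
Qed.

Lemma gap_close_greedy6 : gap_close q (greedy6 q).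
Proof.
move=> m m0; rewrite !size_gaps.
have [|[m6 e]|[_ _ sz cnt]] := g6_aux_greedy m m; first by rewrite m0 /=.
  rewrite /greedy6 e m6 greedy_six; split=> // g; rewrite /gaps /=.
  by case: eqP; case: eqP => *; lia.
by rewrite /greedy6 sz.
Qed.

End Greedy6.
End DeterminedSequences.

(** * Common gap limits and almost sure weak convergence *)

Theorem theorem1p17 (R : realType) (q a : nat -> nat) (decA : nat -> seq nat) :
  FQ_seq q -> Gen41_seq a ->
  (forall m : nat, (0 < m)%N -> gen_legal_dec a (decA m) m) ->
  (forall g : nat, exists Pg : R,
      (fun n => PFQ R q n g) @ \oo --> Pg /\
      (fun n => PGen R decA a n g) @ \oo --> Pg) /\
  (forall (d : measure_display) (Omega : measurableType d)
          (P : probability Omega R) (Z : nat -> Omega -> nat),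
     (forall n m : nat, measurable (Z n @^-1` [set m])) ->
     (forall n m : nat, (1 <= n)%N ->
        P (Z n @^-1` [set m]) =
        (if (q n <= m < q n.+1)%N then ((q n.+1 - q n)%N%:R^-1)%:E else 0%E)) ->
     indep_nat P Z ->
     {ae P, forall w : Omega,
        forall f : R -> R, continuous f -> (exists M : R, forall x, `|f x| <= M) ->
          (fun n => nu_int (greedy6 q (Z n w)) f) @ \oo -->
            limn (fun N => \sum_(0 <= g < N) Plim R q g * f g%:R)}).
Proof.
move=> hQ hA hdec.
have [x x01 x5] := plastic_root_ex R.
have lq := fq_seq_lag5 q hQ; have la := gen_seq_lag5 a hA.
have closeA : gap_close a decA.
  by move=> m m0; rewrite (gen_dec_greedy a decA hA hdec m m0); split=> // g; rewrite !leq_addr.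
have closeQ := gap_close_greedy6 q hQ.
have cvgQ g : (fun n => PFQ R q n g) @ \oo --> limit_gap_prob R x g.
  exact: gap_frac_cvg closeQ g.
split.
  by move=> g; exists (limit_gap_prob R x g); split => //; exact: gap_frac_cvg closeA g.
move=> d Omega P Z mZ distZ _.
have [delta d0 badr] := rare_bad_gaps R q x lq x01 x5 _ closeQ.
(* Countably many g and tolerances 1/(k+1) give a single null set, outside which all bounded
   continuous f are treated at once. *)
have : {ae P, forall w, forall g k, exists N, forall n, (N <= n)%N ->
    good_gaps R x (greedy6 q) delta k.+1%:R^-1 g n (Z n w)}.
  apply: ae_foralln => g; apply: ae_foralln => k.
  have k0 : 0 < k.+1%:R^-1 :> R by rewrite invr_gt0.
  have := ae_rare_eventually R q d Omega P Z mZ distZ _ (badr g _ k0).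
  by apply: filterS => w [N hN]; exists N => n /hN /=; rewrite negbK.
apply: filterS => w good f _ [M fM].
have -> : (fun N => \sum_(0 <= g < N) Plim R q g * f g%:R) =
          (fun N => \sum_(0 <= g < N) limit_gap_prob R x g * f g%:R).
  apply/funext => N; apply: eq_bigr => g _; congr (_ * _).
  by apply/cvg_lim => //; exact: cvgQ.
have sz : \forall n \near \oo, (0 < size (gaps (greedy6 q (Z n w))))%N.
  (* From this instance only the lower bound delta n on the number of gaps is kept. *)
  have [N hN] := good 0%N 0%N; exists (maxn N 1) => // n /= Nn.
  have /andP[dn _] := hN n (leq_trans (leq_maxl _ _) Nn).
  rewrite -(ltr0n R); apply: lt_le_trans dn; rewrite mulr_gt0// ltr0n.
  exact: leq_trans (leq_maxr _ _) Nn.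
apply: (empirical_mean_cvg R (fun n => gaps (greedy6 q (Z n w)))
  (limit_gap_prob R x) (fun g => f g%:R) M) => //.
- by move=> g; apply: limit_gap_prob_ge0; case/andP: x01 => /ltW.
- exact: limit_gap_prob_sum.
move=> g; apply/cvgrPdist_le => /= eps eps0.
(* This k satisfies 1/(k+1) <= eps. *)
have [N hN] := good g (Num.truncn eps^-1).
near=> n.
have s0 : (0 < size (gaps (greedy6 q (Z n w))))%N by near: n.
have Nn : (N <= n)%N by near: n; exists N.
have /andP[_] := hN n Nn.
set s := gaps _ in s0 *; move=> dev.
have z0 : 0 < (size s)%:R :> R by rewrite ltr0n.
rewrite distrC -[X in _ - X](mulfK (lt0r_neq0 z0)) -mulrBl normrM normfV (gtr0_norm z0).
rewrite ler_pdivrMr//; apply: le_trans dev _; rewrite ler_wpM2r//.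
by rewrite invf_ple ?posrE// ltW// truncnS_gt.
Unshelve. all: by end_near.
Qed.
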